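(* For any integer $\gamma \geq 0$, the Hilbert series $\mathcal{H}_{\mathsf{Dendr}_\gamma}(t)$ of the operad $\mathsf{Dendr}_\gamma$ satisfies $$\mathcal{H}_{\mathsf{Dendr}_\gamma}(t) = t + 2\gamma t\, \mathcal{H}_{\mathsf{Dendr}_\gamma}(t) + \gamma^2 t\, \mathcal{H}_{\mathsf{Dendr}_\gamma}(t)^2.$$
   Context: The ground field has characteristic zero; operad means nonsymmetric operad; $[n] = \{1, \dots, n\}$; $a \uparrow a' := \max(a, a')$. The Hilbert series of an operad $\mathcal{O}$ with finite-dimensional components is $\mathcal{H}_{\mathcal{O}}(t) := \sum_{n \geq 1} \dim \mathcal{O}(n)\, t^n$. $\mathbf{Free}(\mathfrak{G})$ is the free operad on a set $\mathfrak{G}$ of binary generators; $(\mathfrak{G}, \mathfrak{R})$ is a presentation of $\mathcal{O}$ if $\mathcal{O} \cong \mathbf{Free}(\mathfrak{G})/\langle \mathfrak{R} \rangle$. Koszul dual: if $\mathcal{O}$ has a presentation $(\mathfrak{G}, \mathfrak{R})$ with $\mathfrak{G}$ in arity $2$ and $\mathfrak{R} \subseteq \mathbf{Free}(\mathfrak{G})(3)$, its Koszul dual is the operad with presentation $(\mathfrak{G}, \mathfrak{R}^\perp)$, where $\mathfrak{R}^\perp$ is the annihilator of $\mathfrak{R}$ in $\mathbf{Free}(\mathfrak{G})(3)$ for the bilinear form with $\langle x \circ_i y, x' \circ_{i'} y' \rangle = 1$ if $x = x', y = y', i = i' = 1$; $= -1$ if $x = x', y = y', i = i' = 2$; and $0$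 otherwise ($x, x', y, y' \in \mathfrak{G}$). $\mathsf{Dias}_\gamma$ is the operad whose arity-$n$ component is spanned by the words of length $n$ on $\{0\} \cup [\gamma]$ with exactly one $0$, with $u \circ_i v := u_1 \dots u_{i-1} \max(u_i, v_1) \dots \max(u_i, v_m) u_{i+1} \dots u_n$. It is presented by generators $\dashv_a, \vdash_a$, $a \in [\gamma]$ (standing for the words $0a$ and $a0$) and the space of relations spanned, for all $a, a' \in [\gamma]$, by $\dashv_a \circ_1 \vdash_{a'} - \vdash_{a'} \circ_2 \dashv_a$; $\dashv_a \circ_1 \dashv_{a \uparrow a'} - \dashv_a \circ_2 \vdash_{a'}$; $\vdash_a \circ_1 \dashv_{a'} - \vdash_a \circ_2 \vdash_{a \uparrow a'}$; $\dashv_{a \uparrow a'} \circ_1 \dashv_a - \dashv_a \circ_2 \dashv_{a'}$; $\vdash_a \circ_1 \vdash_{a'} - \vdash_{a \uparrow a'} \circ_2 \vdash_a$. $\mathsf{Dendr}_\gamma$ is the Koszul dual of $\mathsf{Dias}_\gamma$. *)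

(* Defs.v *)
From HB Require Import structures.
From mathcomp Require Import all_boot all_order all_algebra.
From mathcomp Require Import boolp.

Set Implicit Arguments.
Unset Strict Implicit.
Unset Printing Implicit Defensive.

Import Order.TTheory GRing.Theory.
Local Open Scope ring_scope.

Section LinearAlgebra.
Variables (K : fieldType) (V : vectType K).

Fact span_of_exists (P : V -> Prop) : exists U : {vspace V},
  (forall v, P v -> v \in U) /\
  (forall W : {vspace V}, (forall v, P v -> v \in W) -> (U <= W)%VS).
Proof.
pose p n := `[< exists U : {vspace V}, (forall v, P v -> v \in U) /\ \dim U = n >].
have exp : exists n, p n.
  by exists (\dim {:V}); apply/asboolP; exists fullv; split=> // v _; apply: memvf.
have [n /asboolP[U [PU dU]] minn] := ex_minnP exp.
exists U; split=> // W PW; apply/capv_idPl/eqP.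
rewrite eqEdim capvSl /= dU; apply: minn; apply/asboolP.
by exists (U :&: W)%VS; split=> // v Pv; rewrite memv_cap PU ?PW.
Qed.

(* The smallest subspace containing an arbitrary subset of V. *)
Definition span_of (P : V -> Prop) : {vspace V} :=
  projT1 (cid (span_of_exists P)).

Lemma sub_span_of (P : V -> Prop) v : P v -> v \in span_of P.
Proof. by rewrite /span_of; case: cid => U [? ?] /=; auto. Qed.

Lemma span_of_min (P : V -> Prop) (W : {vspace V}) :
  (forall v, P v -> v \in W) -> (span_of P <= W)%VS.
Proof. by rewrite /span_of; case: cid => U [? ?] /=; auto. Qed.

(* When P is already a linear subspace, span_of P is P itself. *)
Lemma mem_span_of (P : V -> Prop) : P 0 ->
  (forall a u v, P u -> P v -> P (a *: u + v)) ->
  forall v, v \in span_of P <-> P v.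
Proof.
move=> P0 PD v; split; last exact: sub_span_of.
pose p n := `[< exists U : {vspace V}, (forall v, v \in U -> P v) /\ \dim U = n >].
have exp : exists n, p n.
  exists 0%N; apply/asboolP; exists 0%VS; split; last by rewrite dimv0.
  by move=> w; rewrite memv0 => /eqP->.
have ubp n : p n -> (n <= \dim {:V})%N.
  by move=> /asboolP[U [_ <-]]; apply/dimvS/subvf.
have [n /asboolP[U [UP dU]] maxn] := ex_maxnP exp ubp.
move=> vP; apply: (UP); move: vP; apply/subvP; apply: span_of_min => w Pw.
have : p (\dim (<[w]> + U)%VS).
  apply/asboolP; exists (<[w]> + U)%VS; split=> // x /memv_addP[y /vlineP[a ->]].
  by move=> [u Uu ->]; apply: PD => //; apply: UP.
move=> /maxn; rewrite -dU => le_d.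
have /eqP-> : U == (<[w]> + U)%VS by rewrite eqEdim addvSr.
by apply: (subvP (addvSl _ _)); apply: memv_line.
Qed.

(* The library equips {ideal_quot U} with its additive group structure only. *)
Variable U : {vspace V}.

Definition quotv := {ideal_quot U}.
HB.instance Definition _ := GRing.Zmodule.on quotv.

Definition quotv_pi (v : V) : quotv := \pi_({ideal_quot U})%qT v.
Definition quotv_scale (a : K) (x : quotv) : quotv := quotv_pi (a *: repr x).

Lemma quotv_piE u v : (quotv_pi u = quotv_pi v) <-> (u - v \in U).
Proof. by rewrite Quotient.idealrBE; split=> /eqP. Qed.

Lemma quotv_reprK (x : quotv) : quotv_pi (repr x) = x.
Proof. exact: reprK. Qed.

Lemma quotv_pi_repr v : repr (quotv_pi v) - v \in U.
Proof. by apply/quotv_piE; rewrite quotv_reprK. Qed.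

Lemma quotv_piD u v : quotv_pi (u + v) = quotv_pi u + quotv_pi v.
Proof. by rewrite /quotv_pi piE. Qed.

Lemma quotv_piZ a v : quotv_pi (a *: v) = quotv_scale a (quotv_pi v).
Proof.
apply/quotv_piE; rewrite -scalerBr -[v - _]opprB.
by apply: memvZ; rewrite memvN quotv_pi_repr.
Qed.

Fact quotv_scaleA a b x :
  quotv_scale a (quotv_scale b x) = quotv_scale (a * b) x.
Proof. by rewrite -[x]quotv_reprK -!quotv_piZ scalerA. Qed.
Fact quotv_scale1 : left_id 1 quotv_scale.
Proof. by move=> x; rewrite -[x]quotv_reprK -!quotv_piZ scale1r. Qed.
Fact quotv_scaleDr : right_distributive quotv_scale +%R.
Proof.
move=> a x y; rewrite -[x]quotv_reprK -[y]quotv_reprK.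
by rewrite -quotv_piD -!quotv_piZ scalerDr quotv_piD.
Qed.
Fact quotv_scaleDl x : {morph quotv_scale^~ x : a b / a + b}.
Proof.
by move=> a b; rewrite -[x]quotv_reprK -!quotv_piZ scalerDl quotv_piD.
Qed.

HB.instance Definition _ := GRing.Zmodule_isLmodule.Build K quotv
  quotv_scaleA quotv_scale1 quotv_scaleDr quotv_scaleDl.

Fact quotv_pi_is_linear : linear quotv_pi.
Proof. by move=> a u v; rewrite quotv_piD quotv_piZ. Qed.
HB.instance Definition _ :=
  GRing.isLinear.Build K V quotv _ quotv_pi quotv_pi_is_linear.

Fact quotv_vect_iso : Vector.axiom (\dim U^C) quotv.
Proof.
pose f (x : quotv) : 'rV[K]_(\dim U^C) :=
  \row_i coord (vbasis U^C) i (daddv_pi U^C U (repr x)).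
pose g (r : 'rV[K]_(\dim U^C)) : quotv :=
  quotv_pi (\sum_i r 0 i *: (vbasis U^C)`_i).
have capU : (U^C :&: U = 0)%VS by rewrite capvC capv_compl.
have prU v : v \in U -> daddv_pi U^C U v = 0.
  move=> Uv; have capU' : (U :&: U^C = 0)%VS by rewrite capv_compl.
  have := daddv_pi_add capU (w := v); rewrite addvC addv_complf memvf.
  move/(_ isT); rewrite (daddv_pi_id capU' Uv) => e.
  by apply: (addIr v); rewrite e add0r.
have prpi v : daddv_pi U^C U (repr (quotv_pi v)) = daddv_pi U^C U v.
  by apply/eqP; rewrite -subr_eq0 -linearB /= prU // quotv_pi_repr.
exists f.
  move=> a x y; rewrite /f -[x]quotv_reprK -[y]quotv_reprK.
  rewrite -(quotv_pi_is_linear a) !prpi.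
  by apply/rowP=> i; rewrite !mxE !linearP.
exists g.
  move=> x; rewrite /f /g; under eq_bigr do rewrite mxE.
  rewrite -coord_vbasis ?memv_pi // -[RHS]quotv_reprK; apply/quotv_piE.
  rewrite -[X in _ - X](daddv_pi_add capU) ?[(U^C + U)%VS]addvC ?addv_complf ?memvf //.
  by rewrite opprD addrA subrr add0r memvN memv_pi.
move=> r; apply/rowP=> i; rewrite mxE prpi daddv_pi_id //.
  by rewrite coord_sum_free ?(basis_free (vbasisP _)).
by apply: rpred_sum => j _; rewrite rpredZ ?vbasis_mem ?memt_nth.
Qed.
HB.instance Definition _ := Lmodule_hasFinDim.Build K quotv quotv_vect_iso.

End LinearAlgebra.

(* Nonsymmetric operads with finite-dimensional components and no arity 0.
   Arities are shifted by one and inputs are numbered from 0: [O n] is the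
   component O(n+1), and [op_comp i x y] is x o_(i+1) y, whose arity
   (n+1) + (m+1) - 1 is (n+m)+1.  Only the values for i <= n are meaningful. *)

Definition castop (V : nat -> Type) n m (e : n = m) (x : V n) : V m :=
  ecast k (V k) e x.

Record operad (K : fieldType) := Operad {
  op_space :> nat -> vectType K;
  op_unit : op_space 0%N;
  op_comp : forall n m, nat -> op_space n -> op_space m -> op_space (n + m)%N;
  op_compl_linear : forall n m i (y : op_space m), (i <= n)%N ->
    linear (fun x : op_space n => op_comp i x y);
  op_compr_linear : forall n m i (x : op_space n), (i <= n)%N ->
    linear (fun y : op_space m => op_comp i x y);
  op_comp1l : forall m (y : op_space m), op_comp 0 op_unit y = y;
  op_comp1r : forall n i (x : op_space n), (i <= n)%N ->
    op_comp i x op_unit = castop (V := op_space) (esym (addn0 n)) x;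
  op_compA : forall n m p i j
      (x : op_space n) (y : op_space m) (z : op_space p),
    (i <= n)%N -> (j <= m)%N ->
    op_comp (i + j)%N (op_comp i x y) z
    = castop (V := op_space) (addnA n m p) (op_comp i x (op_comp j y z));
  op_compAC : forall n m p i k
      (x : op_space n) (y : op_space m) (z : op_space p),
    (i < k)%N -> (k <= n)%N ->
    op_comp (k + m)%N (op_comp i x y) z
    = castop (V := op_space) (addnAC n p m) (op_comp i (op_comp k x z) y)
}.
Arguments op_unit {K} _.
Arguments op_comp {K} _ {n m} i x y.

Section Ideals.
Variables (K : fieldType) (O : operad K).

Definition is_ideal (I : forall n, {vspace O n}) : Prop :=
  forall n m i (x : O n) (y : O m), (i <= n)%N ->
    (x \in I n -> op_comp O i x y \in I (n + m)%N) /\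
    (y \in I m -> op_comp O i x y \in I (n + m)%N).

Definition gen_ideal k (R : {vspace O k}) n : {vspace O n} :=
  span_of (fun x : O n => forall I : (forall n, {vspace O n}),
             is_ideal I -> (R <= I k)%VS -> x \in I n).

Section Gen.
Variables (k : nat) (R : {vspace O k}).

Lemma mem_gen_ideal n (x : O n) :
  x \in gen_ideal R n <->
  forall I : (forall n, {vspace O n}), is_ideal I -> (R <= I k)%VS -> x \in I n.
Proof.
apply: (mem_span_of (P := fun x : O n => forall I : (forall n, {vspace O n}),
  is_ideal I -> (R <= I k)%VS -> x \in I n)) => [I _ _|a u v uP vP I hI RI].
  exact: mem0v.
by rewrite memvD ?memvZ ?uP ?vP.
Qed.

Lemma gen_ideal_sub : (R <= gen_ideal R k)%VS.
Proof.
by apply/subvP => x Rx; apply/mem_gen_ideal => I _ /subvP; apply.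
Qed.

Lemma gen_ideal_is_ideal : is_ideal (gen_ideal R).
Proof.
move=> n m i x y le_in; split=> /mem_gen_ideal h; apply/mem_gen_ideal => I hI RI.
  by apply: (hI _ _ _ _ _ le_in).1; apply: h.
by apply: (hI _ _ _ _ _ le_in).2; apply: h.
Qed.

End Gen.

Section Quotient.
Variables (I : forall n, {vspace O n}) (idealI : is_ideal I).

Let Q n : vectType K := quotv (I n).
Let pi n (x : O n) : Q n := quotv_pi (I n) x.

Definition quot_comp n m i (x : Q n) (y : Q m) : Q (n + m)%N :=
  pi (op_comp O i (repr x) (repr y)).

Lemma quot_comp_pi n m i (x : O n) (y : O m) : (i <= n)%N ->
  quot_comp i (pi x) (pi y) = pi (op_comp O i x y).
Proof.
move=> le_in; apply/quotv_piE.
have linl := op_compl_linear _ le_in; have linr := op_compr_linear _ le_in.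
have subl z u v : op_comp O i (u - v : O n) z
    = op_comp O i u z - op_comp O i v z :> O (n + m)%N.
  by rewrite -scaleN1r addrC linl scaleN1r addrC.
have subr z u v : op_comp O i z (u - v : O m)
    = op_comp O i z u - op_comp O i z v :> O (n + m)%N.
  by rewrite -scaleN1r addrC linr scaleN1r addrC.
rewrite -(subrKA (op_comp O i x (repr (pi y)))) -subl -subr memvD //.
  by apply: (idealI _ _ le_in).1; apply: quotv_pi_repr.
by apply: (idealI _ _ le_in).2; apply: quotv_pi_repr.
Qed.

Let quot_ind n (P : Q n -> Prop) : (forall x, P (pi x)) -> forall x, P x.
Proof. by move=> h x; rewrite -[x]quotv_reprK; apply: h. Qed.

Let pi_lin n : linear (@pi n).
Proof. exact: quotv_pi_is_linear. Qed.

Let pi_cast n m (e : n = m) x :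
  castop (V := Q) e (pi x) = pi (castop (V := op_space O) e x).
Proof. by case: m / e. Qed.

Fact quot_compl_linear n m i (y : Q m) : (i <= n)%N ->
  linear (fun x : Q n => quot_comp i x y).
Proof.
move=> le_in a u v; elim/quot_ind: y => y; elim/quot_ind: u => u.
elim/quot_ind: v => v; rewrite -pi_lin !quot_comp_pi //.
by rewrite (op_compl_linear _ le_in) pi_lin.
Qed.

Fact quot_compr_linear n m i (x : Q n) : (i <= n)%N ->
  linear (fun y : Q m => quot_comp i x y).
Proof.
move=> le_in a u v; elim/quot_ind: x => x; elim/quot_ind: u => u.
elim/quot_ind: v => v; rewrite -pi_lin !quot_comp_pi //.
by rewrite (op_compr_linear _ le_in) pi_lin.
Qed.

Fact quot_comp1l m (y : Q m) : quot_comp 0 (pi (op_unit O)) y = y.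
Proof. by elim/quot_ind: y => y; rewrite quot_comp_pi // op_comp1l. Qed.

Fact quot_comp1r n i (x : Q n) : (i <= n)%N ->
  quot_comp i x (pi (op_unit O)) = castop (V := Q) (esym (addn0 n)) x.
Proof.
by move=> ?; elim/quot_ind: x => x; rewrite quot_comp_pi // op_comp1r // pi_cast.
Qed.

Fact quot_compA n m p i j (x : Q n) (y : Q m) (z : Q p) :
  (i <= n)%N -> (j <= m)%N ->
  quot_comp (i + j)%N (quot_comp i x y) z
  = castop (V := Q) (addnA n m p) (quot_comp i x (quot_comp j y z)).
Proof.
move=> le_in le_jm; elim/quot_ind: x => x; elim/quot_ind: y => y.
elim/quot_ind: z => z; rewrite !quot_comp_pi ?leq_add // pi_cast.
by rewrite op_compA.
Qed.

Fact quot_compAC n m p i k (x : Q n) (y : Q m) (z : Q p) :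
  (i < k)%N -> (k <= n)%N ->
  quot_comp (k + m)%N (quot_comp i x y) z
  = castop (V := Q) (addnAC n p m) (quot_comp i (quot_comp k x z) y).
Proof.
move=> lt_ik le_kn; elim/quot_ind: x => x; elim/quot_ind: y => y.
have le_in : (i <= n)%N := leq_trans (ltnW lt_ik) le_kn.
elim/quot_ind: z => z; rewrite !quot_comp_pi ?leq_add2r //.
  by rewrite pi_cast op_compAC.
exact: leq_trans le_in (leq_addr _ _).
Qed.

Definition quot_operad : operad K :=
  @Operad K Q (pi (op_unit O)) quot_comp quot_compl_linear quot_compr_linear
    quot_comp1l quot_comp1r quot_compA quot_compAC.

End Quotient.
End Ideals.

(* Planar binary trees with nodes decorated by G. *)
Inductive btree (G : Type) := Leaf | Node of G & btree G & btree G.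
Arguments Leaf {G}.

Section Trees.
Variable G : finType.
Implicit Types (g : G) (t s u : btree G).

Fixpoint encode_btree t : GenTree.tree G :=
  if t is Node g l r then
    GenTree.Node 0 [:: GenTree.Leaf g; encode_btree l; encode_btree r]
  else GenTree.Node 0 [::].

Fixpoint decode_btree (c : GenTree.tree G) : option (btree G) :=
  match c with
  | GenTree.Node _ [::] => Some Leaf
  | GenTree.Node _ [:: GenTree.Leaf g; l; r] =>
      obind (fun l' => omap (Node g l') (decode_btree r)) (decode_btree l)
  | _ => None
  end.

Lemma encode_btreeK : pcancel encode_btree decode_btree.
Proof. by elim=> //= g l -> r ->. Qed.

HB.instance Definition _ := Countable.copy (btree G) (pcan_type encode_btreeK).

Fixpoint nodes t : nat :=
  if t is Node _ l r then (nodes l + nodes r).+1%N else 0%N.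

(* A tree with n nodes has n+1 leaves. *)
Definition tree (n : nat) := {t : btree G | nodes t == n}.
HB.instance Definition _ n := Countable.on (tree n).

Fixpoint trees_upto d : seq (btree G) :=
  if d is d'.+1 then
    Leaf :: [seq Node x.1 x.2.1 x.2.2 |
             x <- [seq (g, lr) | g <- enum G,
                   lr <- [seq (l, r) | l <- trees_upto d', r <- trees_upto d']]]
  else [:: Leaf].

Lemma mem_trees_upto d t : (nodes t <= d)%N -> t \in trees_upto d.
Proof.
elim: d t => [|d IHd] [|g l r] //= le_d; rewrite inE /=.
apply/mapP; exists (g, (l, r)) => //; apply/allpairsP; exists (g, (l, r)).
split; rewrite ?mem_enum //=; apply/allpairsP; exists (l, r) => /=.
split=> //; apply: IHd; first exact: leq_trans (leq_addr _ _) le_d.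
exact: leq_trans (leq_addl _ _) le_d.
Qed.

Definition tree_enum n : seq (tree n) := undup (pmap insub (trees_upto n)).

Fact tree_enumP n : Finite.axiom (tree_enum n).
Proof.
apply: Finite.uniq_enumP; first exact: undup_uniq.
move=> t; rewrite mem_undup mem_pmap_sub; apply/mem_trees_upto.
by rewrite (eqP (valP t)).
Qed.
HB.instance Definition _ n := isFinite.Build (tree n) (@tree_enumP n).

(* [graft i t s] grafts the root of s on the leaf number i of t, leaves being
   numbered from left to right from 0. *)
Fixpoint graft i t s : btree G :=
  if t is Node g l r then
    if (i <= nodes l)%N then Node g (graft i l s) r
    else Node g l (graft (i - (nodes l).+1)%N r s)
  else s.

Lemma nodes_graft i t s : nodes (graft i t s) = (nodes t + nodes s)%N.
Proof.
elim: t i => //= g l IHl r IHr i; case: ifP => _ /=.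
  by rewrite IHl addSn addnAC.
by rewrite IHr addSn addnA.
Qed.

Lemma graft_leaf i t : graft i t Leaf = t.
Proof. by elim: t i => //= g l IHl r IHr i; case: ifP; rewrite ?IHl ?IHr. Qed.

Lemma graftA i j t s u : (i <= nodes t)%N -> (j <= nodes s)%N ->
  graft (i + j)%N (graft i t s) u = graft i t (graft j s u).
Proof.
move=> le_i le_j; elim: t i le_i => [|g l IHl r IHr] i /=.
  by rewrite leqn0 => /eqP->; rewrite add0n.
move=> le_i; case: ifP => le_il /=.
  by rewrite nodes_graft leq_add // IHl.
have lt_li : (nodes l < i)%N by rewrite ltnNge le_il.
rewrite leqNgt (leq_trans lt_li (leq_addr _ _)) /=.
rewrite -addnBAC // IHr // leq_subLR addSn.
exact: le_i.
Qed.

Lemma graftAC i k t s u : (i < k)%N -> (k <= nodes t)%N ->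
  graft (k + nodes s)%N (graft i t s) u = graft i (graft k t u) s.
Proof.
elim: t i k => [|g l IHl r IHr] i k /=.
  by case: k.
move=> lt_ik le_k; case: (leqP k (nodes l)) => [le_kl|lt_lk] /=.
  have le_il : (i <= nodes l)%N := leq_trans (ltnW lt_ik) le_kl.
  rewrite nodes_graft le_il (leq_trans le_il (leq_addr _ _)) /=.
  by rewrite nodes_graft leq_add2r le_kl IHl.
case: (leqP i (nodes l)) => [le_il|lt_li] /=.
  by rewrite nodes_graft leq_add2r leqNgt lt_lk /= -addSn subnDr.
rewrite leqNgt (leq_trans lt_lk (leq_addr _ _)) /= -addnBAC // IHr //.
  by rewrite ltn_sub2rE.
by rewrite leq_subLR addSn.
Qed.

End Trees.

Section Free.
Variables (K : fieldType) (G : finType).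

Definition free_space n : vectType K := {ffun tree G n -> K^o}.

Definition basis_tree n (t : tree G n) : free_space n :=
  [ffun t' => (t' == t)%:R].

Fact tree_graft_proof n m i (t : tree G n) (s : tree G m) :
  nodes (graft i (val t) (val s)) == (n + m)%N.
Proof. by rewrite nodes_graft (eqP (valP t)) (eqP (valP s)). Qed.

Definition tree_graft n m i (t : tree G n) (s : tree G m) : tree G (n + m)%N :=
  exist (fun u => nodes u == n + m)%N _ (tree_graft_proof i t s).

Definition free_comp n m i (x : free_space n) (y : free_space m) :
    free_space (n + m)%N :=
  \sum_t \sum_s (x t * y s) *: basis_tree (tree_graft i t s).

Definition free_unit : free_space 0%N := basis_tree (exist (fun u => nodes u == 0)%N Leaf (eqxx 0%N)).

Lemma free_decomp n (x : free_space n) : x = \sum_t x t *: basis_tree t.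
Proof.
apply/ffunP=> t; rewrite sum_ffunE (bigD1 t) //= !ffunE eqxx big1 ?addr0.
  by rewrite [_ *: _]mulr1.
by move=> s ne_st; rewrite !ffunE eq_sym (negbTE ne_st) scaler0.
Qed.

Lemma free_compl_linear n m i (y : free_space m) :
  linear (fun x : free_space n => free_comp i x y).
Proof.
move=> a u v; rewrite /free_comp scaler_sumr -big_split; apply: eq_bigr => t _.
rewrite scaler_sumr -big_split; apply: eq_bigr => s _ /=.
by rewrite !ffunE mulrDl scalerDl scalerA mulrA.
Qed.

Lemma free_compr_linear n m i (x : free_space n) :
  linear (fun y : free_space m => free_comp i x y).
Proof.
move=> a u v; rewrite /free_comp scaler_sumr -big_split; apply: eq_bigr => t _.
rewrite scaler_sumr -big_split; apply: eq_bigr => s _ /=.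
by rewrite !ffunE mulrDr scalerDl scalerA mulrCA.
Qed.

Lemma free_comp_basis n m i (t : tree G n) (s : tree G m) :
  free_comp i (basis_tree t) (basis_tree s) = basis_tree (tree_graft i t s).
Proof.
rewrite /free_comp (bigD1 t) //= [X in _ + X]big1 => [|t' /negbTE ne].
  rewrite addr0 (bigD1 s) //= big1 => [|s' /negbTE ne].
    by rewrite !ffunE !eqxx mulr1 scale1r addr0.
  by rewrite !ffunE ne mulr0 scale0r.
by rewrite big1 // => s' _; rewrite !ffunE ne mul0r scale0r.
Qed.

Let free_ext n (W : lmodType K) (f g : free_space n -> W) :
  linear f -> linear g -> (forall t, f (basis_tree t) = g (basis_tree t)) ->
  f =1 g.
Proof.
move=> lf lg fg x; rewrite [x]free_decomp.
have f0 : f 0 = 0 by have := lf (-1) 0 0; rewrite !scaleN1r oppr0 addr0 addNr.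
have g0 : g 0 = 0 by have := lg (-1) 0 0; rewrite !scaleN1r oppr0 addr0 addNr.
elim/big_rec: _ => [|t y _ IH]; first by rewrite f0 g0.
by rewrite lf lg IH fg.
Qed.

Let cast_linear n m (e : n = m) : linear (castop (V := free_space) e).
Proof. by case: m / e. Qed.

Let cast_basis n m (e : n = m) (t : tree G n) :
  castop (V := free_space) e (basis_tree t)
  = basis_tree (castop (V := tree G) e t).
Proof. by case: m / e. Qed.

Let val_cast n m (e : n = m) (t : tree G n) :
  val (castop (V := tree G) e t) = val t.
Proof. by case: m / e. Qed.

Fact free_comp1l m (y : free_space m) : free_comp 0 free_unit y = y.
Proof.
apply: (free_ext (f := fun y : free_space m => free_comp 0 free_unit y) (g := id)).
- exact: free_compr_linear.
- by [].
- by move=> t; rewrite free_comp_basis; congr basis_tree; apply: val_inj.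
Qed.

Fact free_comp1r n i (x : free_space n) : (i <= n)%N ->
  free_comp i x free_unit = castop (V := free_space) (esym (addn0 n)) x.
Proof.
move=> _; apply: (free_ext (f := fun x : free_space n => free_comp i x free_unit)).
- exact: free_compl_linear.
- exact: cast_linear.
- move=> t; rewrite free_comp_basis cast_basis; congr basis_tree; apply: val_inj.
  by rewrite val_cast /= graft_leaf.
Qed.

Fact free_compA n m p i j
    (x : free_space n) (y : free_space m) (z : free_space p) :
  (i <= n)%N -> (j <= m)%N ->
  free_comp (i + j)%N (free_comp i x y) z
  = castop (V := free_space) (addnA n m p) (free_comp i x (free_comp j y z)).
Proof.
move=> le_in le_jm; pose L x y z := @free_comp (n + m)%N p (i + j)%N (@free_comp n m i x y) z.
pose R x y z := castop (V := free_space) (addnA n m p)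
  (free_comp i x (@free_comp m p j y z)).
refine (free_ext (f := fun x => L x y z) (g := fun x => R x y z) _ _ _ x).
- by move=> a u v; rewrite /L !free_compl_linear.
- by move=> a u v; rewrite /R free_compl_linear cast_linear.
move=> t; refine (free_ext (f := fun y => L _ y z) (g := fun y => R _ y z) _ _ _ y).
- by move=> a u v; rewrite /L free_compr_linear free_compl_linear.
- by move=> a u v; rewrite /R free_compl_linear free_compr_linear cast_linear.
move=> s; refine (free_ext (f := fun z => L _ _ z) (g := fun z => R _ _ z) _ _ _ z).
- by move=> a u v; rewrite /L free_compr_linear.
- by move=> a u v; rewrite /R !free_compr_linear cast_linear.
move=> r; rewrite /L /R !free_comp_basis cast_basis; congr basis_tree.
apply: val_inj; rewrite val_cast /= graftA //.
  by rewrite (eqP (valP t)).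
by rewrite (eqP (valP s)).
Qed.

Fact free_compAC n m p i k
    (x : free_space n) (y : free_space m) (z : free_space p) :
  (i < k)%N -> (k <= n)%N ->
  free_comp (k + m)%N (free_comp i x y) z
  = castop (V := free_space) (addnAC n p m) (free_comp i (free_comp k x z) y).
Proof.
move=> lt_ik le_kn; pose L x y z := @free_comp (n + m)%N p (k + m)%N (@free_comp n m i x y) z.
pose R x y z := castop (V := free_space) (addnAC n p m)
  (free_comp i (@free_comp n p k x z) y).
refine (free_ext (f := fun x => L x y z) (g := fun x => R x y z) _ _ _ x).
- by move=> a u v; rewrite /L !free_compl_linear.
- by move=> a u v; rewrite /R !free_compl_linear cast_linear.
move=> t; refine (free_ext (f := fun y => L _ y z) (g := fun y => R _ y z) _ _ _ y).
- by move=> a u v; rewrite /L free_compr_linear free_compl_linear.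
- by move=> a u v; rewrite /R free_compr_linear cast_linear.
move=> s; refine (free_ext (f := fun z => L _ _ z) (g := fun z => R _ _ z) _ _ _ z).
- by move=> a u v; rewrite /L free_compr_linear.
- by move=> a u v; rewrite /R free_compr_linear free_compl_linear cast_linear.
move=> r; rewrite /L /R !free_comp_basis cast_basis; congr basis_tree.
apply: val_inj; rewrite val_cast /=.
have := @graftAC G i k (val t) (val s) (val r) lt_ik.
by rewrite (eqP (valP t)) (eqP (valP s)); apply.
Qed.

Definition free_operad : operad K :=
  @Operad K free_space free_unit free_comp
    (fun n m i y _ => @free_compl_linear n m i y)
    (fun n m i x _ => @free_compr_linear n m i x)
    free_comp1l free_comp1r free_compA free_compAC.

Definition gen (g : G) : free_operad 1%N :=
  basis_tree (exist (fun u => nodes u == 1)%N (Node g Leaf Leaf) (eqxx 1%N)).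

(* g o_1 g' and g o_2 g' *)
Definition comp1 (g g' : G) : free_operad 2%N := op_comp free_operad 0 (gen g) (gen g').
Definition comp2 (g g' : G) : free_operad 2%N := op_comp free_operad 1 (gen g) (gen g').

End Free.

(* The bilinear form on the arity-3 component: it is diagonal in the basis of
   trees, with value 1 on trees of shape x o_1 y and -1 on those of shape
   x o_2 y (see koszul_form_comp below). *)
Section Koszul.
Variable K : fieldType.

Definition is_comp1 (G : Type) (t : btree G) : bool :=
  if t is Node _ (Node _ _ _) _ then true else false.

Definition koszul_form (G : finType) (u v : free_operad K G 2%N) : K :=
  \sum_(t : tree G 2) (if is_comp1 (val t) then 1 else -1) * (u t * v t).

Definition annihilator (G : finType) (R : {vspace free_operad K G 2%N}) :
    {vspace free_operad K G 2%N} :=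
  span_of (fun v => forall u, u \in R -> koszul_form u v = 0).

Lemma mem_annihilator (G : finType) (R : {vspace free_operad K G 2%N}) v :
  v \in annihilator R <-> forall u, u \in R -> koszul_form u v = 0.
Proof.
apply: (mem_span_of
  (P := fun v => forall u, u \in R -> koszul_form u v = 0)) => [u _|a x y x0 y0 u Ru].
  by rewrite /koszul_form big1 // => t _; rewrite !ffunE !mulr0.
have -> : koszul_form u (a *: x + y) = a * koszul_form u x + koszul_form u y.
  rewrite /koszul_form mulr_sumr -big_split; apply: eq_bigr => t _ /=.
  by rewrite !ffunE mulrDr mulrDr [u t * _]mulrCA [X in X + _]mulrCA.
by rewrite x0 ?y0 // mulr0 addr0.
Qed.

Lemma koszul_form_comp (G : finType) (b b' : bool) (x y x' y' : G) :
  koszul_form (if b then comp1 K x y else comp2 K x y)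
              (if b' then comp1 K x' y' else comp2 K x' y')
  = if [&& x == x', y == y' & b == b'] then (if b then 1 else -1) else 0.
Proof.
pose T (c : bool) (g h : G) : tree G 2 := if c
  then tree_graft 0 (exist (fun u => nodes u == 1)%N (Node g Leaf Leaf) (eqxx 1%N))
                    (exist (fun u => nodes u == 1)%N (Node h Leaf Leaf) (eqxx 1%N))
  else tree_graft 1 (exist (fun u => nodes u == 1)%N (Node g Leaf Leaf) (eqxx 1%N))
                    (exist (fun u => nodes u == 1)%N (Node h Leaf Leaf) (eqxx 1%N)).
have E (c : bool) g h :
    (if c then comp1 K g h else comp2 K g h) = basis_tree K (T c g h).
  by case: c; rewrite /comp1 /comp2 /gen /= free_comp_basis.
rewrite !E /koszul_form (bigD1 (T b x y)) //= big1 => [|t /negbTE ne]; last first.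
  by rewrite !ffunE ne mul0r mulr0.
rewrite !ffunE eqxx addr0 mul1r.
have -> : is_comp1 (sval (T b x y)) = b by case: (b).
have -> : (T b x y == T b' x' y') = [&& x == x', y == y' & b == b'].
  apply/eqP/and3P => [/(congr1 val)|[/eqP-> /eqP-> /eqP->] //].
  by case: (b) (b') => [] [] //= e; case: e => -> ->; rewrite !eqxx.
by case: [&& _, _ & _]; rewrite ?mulr1 ?mulr0.
Qed.

(* Binary quadratic presentations (generators in arity 2, relations in
   arity 3), the operad they present, and Koszul duality. *)
Record presentation := Presentation {
  generators : finType;
  relations : {vspace free_operad K generators 2%N}
}.

Definition presented_operad (P : presentation) : operad K :=
  quot_operad (gen_ideal_is_ideal (relations P)).

Definition koszul_dual (P : presentation) : presentation :=
  Presentation (annihilator (relations P)).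

End Koszul.

Section Dendr.
Variables (K : fieldType) (gamma : nat).

(* The element a of {1, ..., gamma} is encoded by the ordinal a - 1.  In Dias,
   Dashv a and Vdash a are the words 0a and a0. *)
Inductive dias_gen := Dashv of 'I_gamma | Vdash of 'I_gamma.

Definition dias_gen_sum (x : dias_gen) : 'I_gamma + 'I_gamma :=
  match x with Dashv a => inl a | Vdash a => inr a end.
Definition sum_dias_gen (x : 'I_gamma + 'I_gamma) : dias_gen :=
  match x with inl a => Dashv a | inr a => Vdash a end.
Lemma dias_gen_sumK : cancel dias_gen_sum sum_dias_gen.
Proof. by case. Qed.
HB.instance Definition _ := Finite.copy dias_gen (can_type dias_gen_sumK).

Local Notation "x 'o1' y" := (comp1 K x y) (at level 40).
Local Notation "x 'o2' y" := (comp2 K x y) (at level 40).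
Local Notation "a '\^' b" := (Order.max a b) (at level 35).

Definition dias_relators (a a' : 'I_gamma) :
    seq (free_operad K dias_gen 2%N) :=
  [:: Dashv a o1 Vdash a' - Vdash a' o2 Dashv a;
      Dashv a o1 Dashv (a \^ a') - Dashv a o2 Vdash a';
      Vdash a o1 Dashv a' - Vdash a o2 Vdash (a \^ a');
      Dashv (a \^ a') o1 Dashv a - Dashv a o2 Dashv a';
      Vdash a o1 Vdash a' - Vdash (a \^ a') o2 Vdash a ].

Definition dias_relations : {vspace free_operad K dias_gen 2%N} :=
  (\sum_a \sum_a' <<dias_relators a a'>>)%VS.

Definition dias_presentation : presentation K := Presentation dias_relations.

Definition Dendr : operad K := presented_operad (koszul_dual dias_presentation).

End Dendr.

(* Formal power series over int, as coefficient sequences. *)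
Definition fps := nat -> int.
Definition fps_add (A B : fps) : fps := fun n => A n + B n.
Definition fps_mul (A B : fps) : fps := fun n => \sum_(i < n.+1) A i * B (n - i)%N.
Definition fps_const (c : int) : fps := fun n => if n == 0%N then c else 0.
Definition fps_t : fps := fun n => (n == 1%N)%:R.

Declare Scope fps_scope.
Delimit Scope fps_scope with fps.
Bind Scope fps_scope with fps.
Infix "+" := fps_add : fps_scope.
Infix "*" := fps_mul : fps_scope.
Notation "''t'" := fps_t (at level 0) : fps_scope.
Notation "c %:S" := (fps_const c) (at level 2, format "c %:S") : fps_scope.

(* Because of the arity shift, the coefficient of t^(n+1) is dim (O n). *)
Definition hilbert (K : fieldType) (O : operad K) : fps :=
  fun n => if n is m.+1 then (\dim {:O m})%:Z else 0.

(* Main.v *)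
Require Import Defs.
From HB Require Import structures.
From mathcomp Require Import all_boot all_order all_algebra.
From mathcomp Require Import boolp functions ring.

Set Implicit Arguments.
Unset Strict Implicit.
Unset Printing Implicit Defensive.

Import Order.TTheory GRing.Theory.
Local Open Scope ring_scope.

(** Write [<_a, >_a] for the generators of [Dendr]. Its relations turn out to be
    (x >_b y) <_a z = x >_b (y <_a z),
    (x <_b y) <_a z = sum_{max b d = a} x <_b (y <_d z)
                      + sum_{max a d = b} x <_a (y >_d z),
    x >_a (y >_b z) = sum_{max a d = b} (x <_d y) >_a z
                      + sum_{max b d = a} (x >_d y) >_b z.
    Read from left to right they rewrite every tree into a combination of trees
    indexed by nonempty binary trees with edges labelled in [1, gamma], which
    bounds the dimensions from above.  For the lower bound, the partial sums
    [pre a, suc a] of the [<_d, >_d] over [d <= a] satisfy relations in which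
    only [min a b] occurs, and these hold on the space spanned by the
    edge-labelled trees, which [pre] and [suc] generate from the one-node tree.
    A nonempty edge-labelled tree is a pair of possibly empty trees with a label
    on each nonempty one, so its series H satisfies H = t (1 + gamma H)^2. *)

(** * Linear and bilinear maps given as plain functions *)

Section LinearMaps.
Variables (K : fieldType) (V W : lmodType K) (f : V -> W).
Hypothesis lin_f : linear f.

Let F := HB.pack_for {linear V -> W} f (GRing.isLinear.Build K V W _ f lin_f).

Lemma lin0 : f 0 = 0. Proof. exact: (linear0 F). Qed.
Lemma linD : {morph f : x y / x + y}. Proof. exact: (linearD F). Qed.
Lemma linB : {morph f : x y / x - y}. Proof. exact: (linearB F). Qed.
Lemma linZ a : {morph f : x / a *: x}. Proof. exact: (linearZ_LR F). Qed.
Lemma lin_sum I (r : seq I) (P : pred I) (u : I -> V) :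
  f (\sum_(i <- r | P i) u i) = \sum_(i <- r | P i) f (u i).
Proof. exact: (linear_sum F). Qed.
End LinearMaps.

Definition bilinear_op (K : fieldType) (V : lmodType K) (op : V -> V -> V) :=
  (forall y, linear (op^~ y)) /\ (forall x, linear (op x)).

Section Bilinear.
Variables (K : fieldType) (V : lmodType K) (op : V -> V -> V).
Hypothesis bil : bilinear_op op.

Lemma bilDl x y z : op (x + y) z = op x z + op y z.
Proof. exact: (linD (bil.1 z)). Qed.
Lemma bilDr x y z : op z (x + y) = op z x + op z y.
Proof. exact: (linD (bil.2 z)). Qed.
Lemma bil0l z : op 0 z = 0. Proof. exact: (lin0 (bil.1 z)). Qed.
Lemma bil0r z : op z 0 = 0. Proof. exact: (lin0 (bil.2 z)). Qed.
Lemma bilZl a x z : op (a *: x) z = a *: op x z.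
Proof. exact: (linZ (bil.1 z)). Qed.
Lemma bilZr a x z : op z (a *: x) = a *: op z x.
Proof. exact: (linZ (bil.2 z)). Qed.
Lemma bil_suml I (r : seq I) (P : pred I) (u : I -> V) z :
  op (\sum_(i <- r | P i) u i) z = \sum_(i <- r | P i) op (u i) z.
Proof. exact: (lin_sum (bil.1 z)). Qed.
Lemma bil_sumr I (r : seq I) (P : pred I) (u : I -> V) z :
  op z (\sum_(i <- r | P i) u i) = \sum_(i <- r | P i) op z (u i).
Proof. exact: (lin_sum (bil.2 z)). Qed.
End Bilinear.

(** * Initial sums over a finite chain and their inversion *)

Section InitialSums.
Variables (n : nat) (V : zmodType).
Implicit Types (F G : 'I_n -> V) (a b d : 'I_n).

Lemma initial_sum_recr F a :
  \sum_(d | (d <= a)%O) F d = F a + \sum_(d | (d < a)%O) F d.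
Proof.
rewrite (bigD1 a) //=; congr (_ + _); apply: eq_bigl => d.
by rewrite lt_neqAle andbC.
Qed.

(** Induction along the chain: the terms below [a] already agree and cancel, which leaves the term
    at [a]. *)
Lemma initial_sum_inj F G :
  (forall a, \sum_(d | (d <= a)%O) F d = \sum_(d | (d <= a)%O) G d) -> F =1 G.
Proof.
move=> FG a; have [m] := ubnP (val a); elim: m a => // m IHm a le_am.
have := FG a; rewrite !initial_sum_recr.
rewrite (eq_bigr G) => [|d lt_da]; last first.
  by rewrite IHm // -ltnS (leq_trans _ le_am) // ltnS -ltEord.
exact: addIr.
Qed.

(** Difference of consecutive values, inverse to initial summation. The subtracted sum has one term,
    at the predecessor of [a], and is empty when [a] is least. *)
Definition increment F a := F a - \sum_(b : 'I_n | b.+1 == a :> nat) F b.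

Lemma initial_sum_increment F a :
  \sum_(d | (d <= a)%O) increment F d = F a.
Proof.
have [m] := ubnP (val a); elim: m a => // m IHm a le_am.
rewrite initial_sum_recr {1}/increment -addrA -[RHS]addr0; congr (_ + _).
rewrite addrC; apply/eqP; rewrite subr_eq0; apply/eqP.
case a0: (val a) => [|k].
  by rewrite !big_pred0 // => d; rewrite ltEord /= ?a0.
have lt_kn : (k < n)%N by apply: ltnW; rewrite -a0; apply: ltn_ord.
rewrite [RHS](big_pred1 (Ordinal lt_kn)) => [|d]; last first.
  by rewrite eqSS.
rewrite -IHm /=; last by rewrite -ltnS -a0.
by apply: eq_bigl => d; rewrite ltEord leEord /= a0.
Qed.

End InitialSums.

Lemma initial_sum2_inj n (V : zmodType) (F G : 'I_n -> 'I_n -> V) :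
  (forall a b, \sum_(c | (c <= a)%O) \sum_(d | (d <= b)%O) F c d
             = \sum_(c | (c <= a)%O) \sum_(d | (d <= b)%O) G c d) ->
  F =2 G.
Proof.
move=> FG a b; move: b; apply: initial_sum_inj => b; move: a.
by apply: initial_sum_inj => a.
Qed.

(** A maximum is at most [b] exactly when both of its entries are, so the sum over [d] only leaves
    the constraints [c <= b] and [e <= b]. This is how relations with maxima become relations with
    minima. *)
Lemma initial_sum_max n (V : zmodType) (F : 'I_n -> 'I_n -> V) a b :
  \sum_(c | (c <= a)%O) \sum_(d | (d <= b)%O)
     \sum_(e | Order.max c e == d) F c e
  = \sum_(c | (c <= Order.min a b)%O) \sum_(e | (e <= b)%O) F c e.
Proof.
rewrite [RHS](eq_bigl (fun c => (c <= a)%O && (c <= b)%O)) => [|c]; last first.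
  by rewrite le_min.
rewrite [RHS]big_mkcondr; apply: eq_bigr => c le_ca.
rewrite (exchange_big_dep xpredT) //=; case: ifP => le_cb.
  rewrite [RHS]big_mkcond; apply: eq_bigr => e _.
  case: ifP => le_eb.
    rewrite (big_pred1 (Order.max c e)) // => d.
    apply/andP/eqP => [[_ /eqP<-]//|->]; split=> //.
    by rewrite ge_max le_cb.
  rewrite big_pred0 // => d; apply/andP=> -[le_db /eqP def_d].
  by move: le_db; rewrite -def_d ge_max le_eb andbF.
rewrite big1 // => e _; rewrite big_pred0 // => d.
apply/andP=> -[le_db /eqP def_d].
by move: le_db; rewrite -def_d ge_max le_cb.
Qed.

(** * From relations with minima to the relations of [Dendr] *)

(* The operations [pre a] and [suc a] below are the sums of the generators
   [lt d] and [gt d] over [d <= a]. *)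
Section Polydendriform.
Variables (K : fieldType) (gamma : nat) (V : lmodType K).
Variables pre suc : 'I_gamma -> V -> V -> V.
Hypothesis pre_bil : forall a, bilinear_op (pre a).
Hypothesis suc_bil : forall a, bilinear_op (suc a).
Hypothesis suc_pre : forall a b x y z,
  pre a (suc b x y) z = suc b x (pre a y z).
Hypothesis pre_pre : forall a b x y z,
  pre a (pre b x y) z = pre (Order.min b a) x (pre a y z + suc b y z).
Hypothesis suc_suc : forall a b x y z,
  suc a x (suc b y z) = suc (Order.min a b) (pre b x y + suc a x y) z.

Definition lt_op a x y := increment (fun b => pre b x y) a.
Definition gt_op a x y := increment (fun b => suc b x y) a.

Lemma increment_bilinear (op : 'I_gamma -> V -> V -> V) a :
  (forall b, bilinear_op (op b)) ->
  bilinear_op (fun x y => increment (fun b => op b x y) a).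
Proof.
move=> bil; split=> y k u v; rewrite /increment scalerBr addrACA -opprD.
  rewrite ((bil a).1 y) scaler_sumr -big_split; congr (_ - _).
  by apply: eq_bigr => b _; rewrite ((bil b).1 y).
rewrite ((bil a).2 y) scaler_sumr -big_split; congr (_ - _).
by apply: eq_bigr => b _; rewrite ((bil b).2 y).
Qed.

Lemma lt_op_bil a : bilinear_op (lt_op a).
Proof. exact: increment_bilinear. Qed.
Lemma gt_op_bil a : bilinear_op (gt_op a).
Proof. exact: increment_bilinear. Qed.

Lemma sum_lt_op a x y : \sum_(d | (d <= a)%O) lt_op d x y = pre a x y.
Proof. exact: initial_sum_increment. Qed.
Lemma sum_gt_op a x y : \sum_(d | (d <= a)%O) gt_op d x y = suc a x y.
Proof. exact: initial_sum_increment. Qed.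

(** By bilinearity, the double initial sums over [a] and [b] of the two sides are the two sides of
    [suc_pre]; inverting these sums gives the identity. *)
Lemma lt_gt_op a b x y z :
  lt_op a (gt_op b x y) z = gt_op b x (lt_op a y z).
Proof.
pose F (a b : 'I_gamma) := lt_op a (gt_op b x y) z.
pose G (a b : 'I_gamma) := gt_op b x (lt_op a y z).
apply: (@initial_sum2_inj _ _ F G) => {}a {}b; rewrite /F /G.
under eq_bigr => c _ do rewrite -(bil_suml (lt_op_bil c)) sum_gt_op.
rewrite sum_lt_op [RHS]exchange_big /=.
under [RHS]eq_bigr => c _ do rewrite -(bil_sumr (gt_op_bil c)) sum_lt_op.
by rewrite sum_gt_op suc_pre.
Qed.

(** After double initial summation the left side is that of [pre_pre], and both sums over maxima
    become sums over [c <= min a b], which assemble into its right side. *)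
Lemma lt_lt_op a b x y z :
  lt_op a (lt_op b x y) z
  = \sum_(d | Order.max b d == a) lt_op b x (lt_op d y z)
    + \sum_(d | Order.max a d == b) lt_op a x (gt_op d y z).
Proof.
pose F (b a : 'I_gamma) := lt_op a (lt_op b x y) z.
pose G (b a : 'I_gamma) := \sum_(d | Order.max b d == a) lt_op b x (lt_op d y z)
    + \sum_(d | Order.max a d == b) lt_op a x (gt_op d y z).
apply: (@initial_sum2_inj _ _ F G) => {}b {}a; rewrite /F /G.
rewrite exchange_big /=.
under eq_bigr => c _ do rewrite -(bil_suml (lt_op_bil c)) sum_lt_op.
rewrite sum_lt_op pre_pre.
under [RHS]eq_bigr => c _ do rewrite big_split /=.
(* In the second sum the roles of [a] and [b] are interchanged, so its two outer summations are
   swapped before [initial_sum_max] is applied. *)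
rewrite big_split /= [X in _ = _ + X]exchange_big /=.
rewrite (initial_sum_max (fun c d => lt_op c x (lt_op d y z))).
rewrite (initial_sum_max (fun c d => lt_op c x (gt_op d y z))).
rewrite [Order.min a b]minC -big_split -sum_lt_op; apply: eq_bigr => c _ /=.
by rewrite -!(bil_sumr (lt_op_bil c)) -(bilDr (lt_op_bil c)) sum_lt_op sum_gt_op.
Qed.

Lemma gt_gt_op a b x y z :
  gt_op a x (gt_op b y z)
  = \sum_(d | Order.max a d == b) gt_op a (lt_op d x y) z
    + \sum_(d | Order.max b d == a) gt_op b (gt_op d x y) z.
Proof.
pose F (a b : 'I_gamma) := gt_op a x (gt_op b y z).
pose G (a b : 'I_gamma) := \sum_(d | Order.max a d == b) gt_op a (lt_op d x y) z
    + \sum_(d | Order.max b d == a) gt_op b (gt_op d x y) z.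
apply: (@initial_sum2_inj _ _ F G) => {}a {}b; rewrite /F /G.
under eq_bigr => c _ do rewrite -(bil_sumr (gt_op_bil c)) sum_gt_op.
rewrite sum_gt_op suc_suc.
under [RHS]eq_bigr => c _ do rewrite big_split /=.
rewrite big_split /= [X in _ = _ + X]exchange_big /=.
rewrite (initial_sum_max (fun c d => gt_op c (lt_op d x y) z)).
rewrite (initial_sum_max (fun c d => gt_op c (gt_op d x y) z)).
rewrite [Order.min b a]minC -big_split -sum_gt_op; apply: eq_bigr => c _ /=.
by rewrite -!(bil_suml (gt_op_bil c)) -(bilDl (gt_op_bil c)) sum_lt_op sum_gt_op.
Qed.

End Polydendriform.

(** * A model on edge-labelled binary trees *)

Section Model.
Variables (K : fieldType) (gamma : nat).
Notation label := 'I_gamma.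
Notation etree := (btree label).

(* A nonempty binary tree whose edges are labelled is coded by the pair of its
   subtrees, the label of an edge being stored in the node below it.  The model
   consists of the infinite linear combinations of such trees. *)
Notation model := (etree -> etree -> K^o).
Implicit Types (f g h : model) (a b c : label) (l r u v : etree).

(** Slices of [f]: one subtree of the root is held fixed, while the other one, nonempty with edge
    label [b], becomes the new tree. *)
Definition left_part b r f : model := fun u v => f (Node b u v) r.
Definition right_part b l f : model := fun u v => f l (Node b u v).

(* On trees, (l, R) < s = (l, s) with the new edge labelled a when R is empty,
   and otherwise (l, R) < s = (l, R *_(a,b) s) with the new edge labelled
   min a b, where b labels the edge to R and *_(a,b) = pre a + suc b; the
   clauses below read off the coefficients. *)
Fixpoint pre a f g l r {struct r} : K^o :=
  if r is Node c u v then
    (c == a)%:R * (f l Leaf * g u v)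
    + \sum_(b | Order.min a b == c)
        (pre a (right_part b l f) g u v + suc b (right_part b l f) g u v)
  else 0
with suc a f g l r {struct l} : K^o :=
  if l is Node c u v then
    (c == a)%:R * (f u v * g Leaf r)
    + \sum_(b | Order.min a b == c)
        (pre b f (left_part b r g) u v + suc a f (left_part b r g) u v)
  else 0.

Lemma pre_suc_linear u :
  [/\ forall l a k f f' g,
        pre a (k *: f + f') g l u = k * pre a f g l u + pre a f' g l u,
      forall l a k f g g',
        pre a f (k *: g + g') l u = k * pre a f g l u + pre a f g' l u,
      forall r a k f f' g,
        suc a (k *: f + f') g u r = k * suc a f g u r + suc a f' g u r
    & forall r a k f g g',
        suc a f (k *: g + g') u r = k * suc a f g u r + suc a f g' u r].
Proof.
elim: u => [|c u [_ _ su1 su2] v [pv1 pv2 _ _]] /=.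
  by split=> *; rewrite mulr0 addr0.
have big_lin (P : pred label) (k : K^o) (F G H : label -> K^o) :
    (forall b, F b = k * G b + H b) ->
    \sum_(b | P b) F b = k * (\sum_(b | P b) G b) + \sum_(b | P b) H b.
  move=> FGH; rewrite mulr_sumr -big_split; apply: eq_bigr => b _; exact: FGH.
have dist (k x y x' y' z z' : K^o) : z = k * x + y -> z' = k * x' + y' ->
    z + z' = k * (x + x') + (y + y').
  by move=> -> ->; rewrite mulrDr addrACA.
have linl (d k x y z : K) : d * ((k * x + y) * z) = k * (d * (x * z)) + d * (y * z).
  ring.
have linr (d k x y z : K) : d * (z * (k * x + y)) = k * (d * (z * x)) + d * (z * y).
  ring.
split=> [l|l|r|r] a k f g g'; apply dist.
- exact: linl.
- by apply: big_lin => b; apply dist; [apply: pv1|apply: su1].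
- exact: linr.
- by apply: big_lin => b; apply dist; [apply: pv2|apply: su2].
- exact: linl.
- by apply: big_lin => b; apply dist; [apply: pv1|apply: su1].
- exact: linr.
- by apply: big_lin => b; apply dist; [apply: pv2|apply: su2].
Qed.

Lemma pre_bil a : bilinear_op (pre a).
Proof.
split=> g k f f'; apply: funext => l; apply: funext => r;
  by have [p1 p2 _ _] := pre_suc_linear r; rewrite ?p1 ?p2.
Qed.

Lemma suc_bil a : bilinear_op (suc a).
Proof.
split=> g k f f'; apply: funext => l; apply: funext => r;
  by have [_ _ s1 s2] := pre_suc_linear l; rewrite ?s1 ?s2.
Qed.

(** A given coefficient of [pre a f g] or [suc a f g] is a finite linear combination of coefficients
    of [g], so a linear functional in the parameter [t] passes to [g]. *)
Lemma functional_pre_suc (phi : (etree -> K^o) -> K^o) u : linear phi ->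
  (forall l a f (g : etree -> model),
     phi (fun t => pre a f (g t) l u)
     = pre a f (fun p q => phi (fun t => g t p q)) l u) /\
  (forall r a f (g : etree -> model),
     phi (fun t => suc a f (g t) u r)
     = suc a f (fun p q => phi (fun t => g t p q)) u r).
Proof.
move=> lin_phi; have phi0 : phi (fun=> 0) = 0 by exact: lin0 lin_phi.
have phi_step d k (F : etree -> K^o) (P : pred label)
      (G H : label -> etree -> K^o) :
    phi (fun t => d * (k * F t) + \sum_(b | P b) (G b t + H b t))
    = d * (k * phi F) + \sum_(b | P b) (phi (G b) + phi (H b)).
  have -> : (fun t => d * (k * F t) + \sum_(b | P b) (G b t + H b t))
      = d *: (k *: F) + \sum_(b | P b) (G b + H b).
    by apply: funext => t; rewrite !fctE fct_sumE.
  rewrite (linD lin_phi) !(linZ lin_phi) (lin_sum lin_phi).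
  by congr (_ + _); apply: eq_bigr => b _; rewrite (linD lin_phi).
elim: u => [|c u [_ IHsu] v [IHpv _]] /=; first by [].
split=> [l|r] a f g; rewrite phi_step; congr (_ + _); apply: eq_bigr => b _.
  by rewrite IHpv IHsu.
by rewrite IHpv IHsu.
Qed.

(** The two products act on different sides of the root of [g]: [suc] on left subtrees and [pre] on
    right ones. *)
Lemma suc_pre a b f g h : pre a (suc b f g) h = suc b f (pre a g h).
Proof.
apply: funext => l; apply: funext => r.
(* The coefficient of [pre a f' h] at [(l', r)] depends on [f'] only through the row [f' l']; [phi]
   is this functional, and the [Leaf] in it is a dummy. *)
pose phi (w : etree -> K^o) := pre a (fun=> w) h Leaf r.
have phiE f' l' : pre a f' h l' r = phi (f' l') by rewrite /phi; case: (r).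
have lin_phi : linear phi.
  move=> k w w'; have /= := (pre_bil a).1 h k (fun=> w) (fun=> w').
  by move=> /(congr1 (fun f' => f' Leaf r)).
(* Dually, the coefficient at [(l, t)] depends on [g'] only through its column at [t]. *)
have sucE g' t : suc b f g' l t = suc b f (fun p _ => g' p t) l Leaf.
  by case: (l).
rewrite phiE sucE.
under [in RHS]eq_fun2 => p q do rewrite phiE.
rewrite -[RHS]((functional_pre_suc l lin_phi).2 Leaf b f (fun t p _ => g p t)).
by congr phi; apply: funext => t; rewrite sucE.
Qed.

Definition star a b f g := pre a f g + suc b f g.

Lemma star_bil a b : bilinear_op (star a b).
Proof.
split=> g k f f'; rewrite /star scalerDr addrACA.
  by rewrite ((pre_bil a).1 g) ((suc_bil b).1 g).
by rewrite ((pre_bil a).2 g) ((suc_bil b).2 g).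
Qed.

Lemma pre_Node a f g l c u v :
  pre a f g l (Node c u v)
  = (c == a)%:R * (f l Leaf * g u v)
    + \sum_(b | Order.min a b == c) star a b (right_part b l f) g u v.
Proof. by []. Qed.

Lemma suc_Node a f g c u v r :
  suc a f g (Node c u v) r
  = (c == a)%:R * (f u v * g Leaf r)
    + \sum_(b | Order.min a b == c) star b a f (left_part b r g) u v.
Proof. by []. Qed.

Lemma left_part_suc a b f g r :
  left_part b r (suc a f g)
  = (b == a)%:R *: ((g Leaf r : K) *: f)
    + \sum_(c | Order.min a c == b)
        star c a f (left_part c r g).
Proof.
apply: funext => u; apply: funext => v; rewrite !fct_sumE /left_part /=.
by rewrite !fctE /= !fct_sumE [f u v * _]mulrC.
Qed.

Lemma right_part_pre a b f g l :
  right_part b l (pre a f g)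
  = (b == a)%:R *: ((f l Leaf : K) *: g)
    + \sum_(c | Order.min a c == b)
        star a c (right_part c l f) g.
Proof.
apply: funext => u; apply: funext => v; rewrite !fct_sumE /right_part /=.
by rewrite !fctE /= !fct_sumE.
Qed.

(** Both identities are proved together: comparing coefficients at [Node c u v] reduces each of them
    to an associativity of [star] at [(u, v)], which uses the first identity at [v] and the second
    one at [u]. *)
Lemma pre_pre_suc_suc u :
  (forall l a b f g h,
     pre a (pre b f g) h l u = pre (Order.min b a) f (star a b g h) l u) /\
  (forall r a b f g h,
     suc a f (suc b g h) u r = suc (Order.min a b) (star b a f g) h u r).
Proof.
elim: u => [|c u [_ IHsu] v [IHpv _]] //.
(* Both sides expand into three terms: the middle ones agree by [suc_pre], the outer ones by the two
   induction hypotheses. *)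
have star_star a b d f g h :
    star a (Order.min b d) (star b d f g) h u v
    = star (Order.min b a) d f (star a b g h) u v.
  have -> : star a (Order.min b d) (star b d f g) h
      = pre a (pre b f g) h + suc d f (pre a g h)
        + suc (Order.min b d) (star b d f g) h.
    by rewrite {1}/star {1}/star (bilDl (pre_bil a)) suc_pre.
  have -> : star (Order.min b a) d f (star a b g h)
      = pre (Order.min b a) f (star a b g h)
        + suc d f (pre a g h) + suc d f (suc b g h).
    by rewrite {1}/star {2}/star (bilDr (suc_bil d)) addrA.
  by rewrite !fctE IHpv IHsu [Order.min d b]minC.
(* The intermediate label [e] is eliminated, and [min a (min b d)] is regrouped as
   [min (min a b) d]. *)
have reindex a b (x : K) (y : label -> K) F G c' :
    (forall d, F (Order.min b d) d = G d) ->
    \sum_(e | Order.min a e == c')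
       ((e == b)%:R * (x * y e) + \sum_(d | Order.min b d == e) F e d)
    = (c' == Order.min a b)%:R * (x * y b)
      + \sum_(d | Order.min (Order.min a b) d == c') G d.
  move=> FG; rewrite big_split /=; congr (_ + _).
    rewrite big_mkcond (bigD1 b) //= eqxx mul1r big1 => [|e /negbTE->].
      by rewrite addr0 eq_sym; case: eqP; rewrite ?mul1r ?mul0r.
    by rewrite mul0r if_same.
  rewrite (exchange_big_dep xpredT) //= [RHS]big_mkcond; apply: eq_bigr => d _.
  rewrite -minA -FG.
  case: eqP => [def_c|ne_c].
    rewrite (big_pred1 (Order.min b d)) // => e.
    rewrite [RHS]eq_sym andb_idl // => /eqP<-; exact/eqP.
  rewrite big_pred0 // => e; apply/andP => -[/eqP ? /eqP def_e].
  by case: ne_c; rewrite def_e.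
split=> [l|r] a b f g h.
  rewrite !pre_Node [pre b f g l Leaf]/= mul0r mulr0 add0r.
  under eq_bigr => e _.
    rewrite right_part_pre (bilDl (star_bil _ _)) !(bilZl (star_bil _ _)).
    rewrite (bil_suml (star_bil _ _)) !fctE !fct_sumE.
    over.
  rewrite (reindex _ _ _ (fun e => star a e g h u v) _ _ _
    (fun d => star_star a b d _ _ _)).
  by rewrite [Order.min b a]minC.
rewrite !suc_Node [suc b g h Leaf r]/= !mulr0 add0r.
under eq_bigr => e _.
  rewrite left_part_suc (bilDr (star_bil _ _)) !(bilZr (star_bil _ _)).
  rewrite (bil_sumr (star_bil _ _)) !fctE !fct_sumE.
  over.
rewrite (reindex _ _ _ (fun e => star e a f g u v) _
  (fun d => star d (Order.min a b) (star b a f g) (left_part d r h) u v)).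
  by rewrite [h _ _ * _]mulrC.
by move=> d; rewrite -star_star [Order.min b a]minC.
Qed.

Lemma pre_pre a b f g h :
  pre a (pre b f g) h = pre (Order.min b a) f (star a b g h).
Proof.
apply: funext => l; apply: funext => r.
exact: (pre_pre_suc_suc r).1.
Qed.

Lemma suc_suc a b f g h :
  suc a f (suc b g h) = suc (Order.min a b) (star b a f g) h.
Proof.
apply: funext => l; apply: funext => r.
exact: (pre_pre_suc_suc l).2.
Qed.

End Model.

(** * Evaluation of trees in an algebra and the ideal of its identities *)

Section Evaluation.
Variables (K : fieldType) (G : finType) (V : lmodType K).
Variable op : G -> V -> V -> V.
Hypothesis op_bil : forall g, bilinear_op (op g).
Implicit Types (t s : btree G) (X : nat -> V).

Definition tail_from k X : nat -> V := fun j => X (k + j)%N.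

(** The leaves receive [X 0], [X 1], ... from left to right; [X] is an infinite sequence so that no
    arity enters its type. *)
Fixpoint tree_eval t X : V :=
  if t is Node g l r then
    op g (tree_eval l X) (tree_eval r (tail_from (nodes l).+1 X))
  else X 0%N.

Lemma eq_tree_eval t X X' :
  (forall j, (j <= nodes t)%N -> X j = X' j) -> tree_eval t X = tree_eval t X'.
Proof.
elim: t X X' => [|g l IHl r IHr] X X' /= eqX; first exact: eqX.
congr op; [apply: IHl|apply: IHr] => j le_j; apply: eqX.
  by rewrite -addSn (leq_trans le_j) // ltnW // leq_addr.
by rewrite /= addSn ltnS leq_add2l.
Qed.

(** The inputs seen by a tree after a tree with [m] nodes and value [a] is grafted on its leaf [i]:
    the later leaves are shifted by [m], as one leaf is replaced by [m + 1]. *)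
Definition plug i (a : V) m X : nat -> V :=
  fun j => if (j < i)%N then X j else if j == i then a else X (j + m)%N.

Lemma tree_eval_graft i t s X : (i <= nodes t)%N ->
  tree_eval (graft i t s) X
  = tree_eval t (plug i (tree_eval s (tail_from i X)) (nodes s) X).
Proof.
elim: t i X => [|g l IHl r IHr] i X /=.
  by rewrite leqn0 => /eqP->.
move=> le_i; case: leqP => [le_il|lt_li] /=.
  rewrite IHl // nodes_graft; congr op; apply: eq_tree_eval => j _.
  have lt_ij : (i < (nodes l).+1 + j)%N.
    by rewrite addSn ltnS (leq_trans le_il) ?leq_addr.
  by rewrite /tail_from /plug ltnNge (ltnW lt_ij) /= gtn_eqF // !addSn addnAC.
rewrite IHr; last by rewrite leq_subLR addSn.
congr op; apply: eq_tree_eval => j le_j.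
  by rewrite /plug (leq_ltn_trans le_j lt_li).
have [k def_i] : exists k, i = ((nodes l).+1 + k)%N.
  by exists (i - (nodes l).+1)%N; rewrite subnKC.
rewrite /tail_from /plug def_i addKn ltn_add2l eqn_add2l.
case: ltnP => // _; case: eqP => _; last by rewrite addnA.
by apply: eq_tree_eval => q _; rewrite addnA.
Qed.

(** The value of [t] is linear in its leaf [i], and since all [s k] have the same size, the other
    leaves receive the same inputs for every [k]. *)
Lemma sum_tree_eval_graft (I : finType) (c : I -> K) (s : I -> btree G) m i t X :
  (forall k, nodes (s k) = m) -> (i <= nodes t)%N ->
  \sum_k c k *: tree_eval (s k) (tail_from i X) = 0 ->
  \sum_k c k *: tree_eval (graft i t (s k)) X = 0.
Proof.
move=> size_s; elim: t i X => [|g l IHl r IHr] i X /=.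
  by rewrite leqn0 => /eqP->.
move=> le_i; case: leqP => [le_il|lt_li] /= s0.
  under eq_bigr => k _ do rewrite nodes_graft size_s -(bilZl (op_bil g)).
  by rewrite -(bil_suml (op_bil g)) IHl // (bil0l (op_bil g)).
under eq_bigr => k _ do rewrite -(bilZr (op_bil g)).
rewrite -(bil_sumr (op_bil g)) IHr ?(bil0r (op_bil g)) //.
  by rewrite leq_subLR addSn.
rewrite -[RHS]s0; apply: eq_bigr => k _; congr (_ *: _).
by apply: eq_tree_eval => j _; rewrite /tail_from addnA subnKC.
Qed.

Definition free_eval n X (x : free_space K G n) : V :=
  \sum_t x t *: tree_eval (val t) X.

Lemma free_eval_linear n X : linear (@free_eval n X).
Proof.
move=> a x y; rewrite /free_eval scaler_sumr -big_split; apply: eq_bigr => t _.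
by rewrite !ffunE /= scalerDl scalerA.
Qed.

Lemma free_eval_basis n X (t : tree G n) :
  free_eval X (basis_tree K t) = tree_eval (val t) X.
Proof.
rewrite /free_eval (bigD1 t) //= big1 => [|s /negbTE ne].
  by rewrite !ffunE eqxx scale1r addr0.
by rewrite !ffunE ne scale0r.
Qed.

Lemma free_eval_comp n m i X (x : free_space K G n) (y : free_space K G m) :
  free_eval X (free_comp i x y)
  = \sum_t \sum_s (x t * y s) *: tree_eval (graft i (val t) (val s)) X.
Proof.
rewrite /free_comp (lin_sum (free_eval_linear X)); apply: eq_bigr => t _.
rewrite (lin_sum (free_eval_linear X)); apply: eq_bigr => s _.
by rewrite (linZ (free_eval_linear X)) free_eval_basis.
Qed.

Definition identities n : {vspace free_operad K G n} :=
  span_of (fun x : free_operad K G n => forall X, free_eval X x = 0).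

Lemma mem_identities n x :
  x \in identities n <-> forall X, free_eval X x = 0.
Proof.
apply: mem_span_of => [X|a u v u0 v0 X]; first exact: lin0 (free_eval_linear X).
by rewrite free_eval_linear u0 v0 scaler0 addr0.
Qed.

(** Grafting into an identity changes only its inputs, and grafting an identity on a leaf puts the
    value 0 there. Hence once some relations hold in [V], so does the whole ideal they generate. *)
Lemma identities_ideal : is_ideal (O := free_operad K G) identities.
Proof.
move=> n m i x y le_in; split=> /mem_identities x0; apply/mem_identities => X;
  rewrite free_eval_comp.
  rewrite exchange_big /= big1 // => s _.
  under eq_bigr => t _.
    rewrite mulrC -scalerA tree_eval_graft; last by rewrite (eqP (valP t)).
    over.
  by rewrite -scaler_sumr -[X in _ *: X]/(free_eval _ x) x0 scaler0.
rewrite big1 // => t _; under eq_bigr => s _ do rewrite -scalerA.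
rewrite -scaler_sumr (sum_tree_eval_graft (m := m)) ?scaler0 //.
- by move=> s; rewrite (eqP (valP s)).
- by rewrite (eqP (valP t)).
- exact: x0.
Qed.

End Evaluation.

(** * Coordinates on the arity-3 component *)

Section Arity3.
Variables (K : fieldType) (G : finType).
Implicit Types (g h : G).

Definition corolla g : tree G 1 :=
  exist (fun u => nodes u == 1)%N (Node g Leaf Leaf) (eqxx 1%N).
Definition left_comb g h : tree G 2 := tree_graft 0 (corolla g) (corolla h).
Definition right_comb g h : tree G 2 := tree_graft 1 (corolla g) (corolla h).

Lemma comp1E g h : comp1 K g h = basis_tree K (left_comb g h).
Proof. by rewrite /comp1 /comp2 /gen /= free_comp_basis. Qed.
Lemma comp2E g h : comp2 K g h = basis_tree K (right_comb g h).
Proof. by rewrite /comp1 /comp2 /gen /= free_comp_basis. Qed.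

(** The second node of a tree with two nodes is either the left or the right child of the root. *)
Lemma sum_tree2 (W : nmodType) (F : tree G 2 -> W) :
  \sum_t F t
  = \sum_g \sum_h F (left_comb g h) + \sum_g \sum_h F (right_comb g h).
Proof.
pose comb (p : (G * G) + (G * G)) : tree G 2 :=
  match p with
  | inl (g, h) => left_comb g h
  | inr (g, h) => right_comb g h
  end.
have comb_inj : injective comb.
  by move=> [[g h]|[g h]] [[g' h']|[g' h']] //= /(congr1 val) [-> ->].
have comb_surj t : exists p, comb p = t.
  case: t => -[|g [|h l r] [|h' l' r']] //= size_t; last first.
  - by exfalso; move: size_t; rewrite !addnS.
  - exists (inl (g, h)); apply: val_inj => /=.
    by case: l r size_t => [|? ? ?] [|? ? ?] //=; rewrite ?addnS.
  - exists (inr (g, h')); apply: val_inj => /=.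
    by case: l' r' size_t => [|? ? ?] [|? ? ?] //=; rewrite ?addnS.
have [f fK] := fin_all_exists comb_surj.
have comb_bij : bijective comb.
  by exists f => // p; apply: comb_inj.
rewrite (reindex comb); last exact: onW_bij.
by rewrite big_sumType /= !pair_big; congr (_ + _); apply: eq_bigr => -[].
Qed.

Definition left_coef g h (v : free_operad K G 2%N) : K^o :=
  (v : free_space K G 2) (left_comb g h).
Definition right_coef g h (v : free_operad K G 2%N) : K^o :=
  (v : free_space K G 2) (right_comb g h).

Lemma left_coef_linear g h : linear (left_coef g h).
Proof. by move=> a x y; rewrite /left_coef !ffunE. Qed.
Lemma right_coef_linear g h : linear (right_coef g h).
Proof. by move=> a x y; rewrite /right_coef !ffunE. Qed.

Lemma left_coef_comp1 g h g' h' :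
  left_coef g h (comp1 K g' h') = ((g == g') && (h == h'))%:R.
Proof.
rewrite comp1E /left_coef ffunE; congr (nat_of_bool _)%:R.
by apply/eqP/andP => [[-> ->]|[/eqP-> /eqP->]].
Qed.
Lemma right_coef_comp2 g h g' h' :
  right_coef g h (comp2 K g' h') = ((g == g') && (h == h'))%:R.
Proof.
rewrite comp2E /right_coef ffunE; congr (nat_of_bool _)%:R.
by apply/eqP/andP => [[-> ->]|[/eqP-> /eqP->]].
Qed.
Lemma right_coef_comp1 g h g' h' : right_coef g h (comp1 K g' h') = 0.
Proof.
by rewrite comp1E /right_coef ffunE; case: eqP => // /(congr1 val).
Qed.
Lemma left_coef_comp2 g h g' h' : left_coef g h (comp2 K g' h') = 0.
Proof.
by rewrite comp2E /left_coef ffunE; case: eqP => // /(congr1 val).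
Qed.

Lemma koszul_form_linear (v : free_operad K G 2%N) :
  linear ((@koszul_form K G)^~ v : free_operad K G 2%N -> K^o).
Proof.
move=> a x y; rewrite /koszul_form scaler_sumr -big_split; apply: eq_bigr => t _.
rewrite !ffunE /= mulrDl mulrDr -mulrA mulrCA; congr (_ + _).
Qed.

Lemma koszul_form_comp1 g h (v : free_operad K G 2%N) :
  koszul_form (comp1 K g h) v = left_coef g h v.
Proof.
rewrite /koszul_form comp1E (bigD1 (left_comb g h)) //= big1 => [|t /negbTE ne].
  by rewrite ffunE eqxx addr0 !mul1r.
by rewrite ffunE ne mul0r mulr0.
Qed.

Lemma koszul_form_comp2 g h (v : free_operad K G 2%N) :
  koszul_form (comp2 K g h) v = - right_coef g h v.
Proof.
rewrite /koszul_form comp2E (bigD1 (right_comb g h)) //= big1 => [|t /negbTE ne].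
  by rewrite ffunE eqxx addr0 mul1r mulN1r.
by rewrite ffunE ne mul0r mulr0.
Qed.

End Arity3.

(** * The relations of [Dendr], computed as an annihilator *)

Section KoszulDual.
Variables (K : fieldType) (gamma : nat).
Notation label := 'I_gamma.
Notation dgen := (dias_gen gamma).
Notation lft v g h := (left_coef g h v).
Notation rgt v g h := (right_coef g h v).
Implicit Types (a b c d : label).

Lemma big_dias_gen (W : nmodType) (F : dgen -> W) :
  \sum_g F g = \sum_a F (Dashv a) + \sum_a F (Vdash a).
Proof.
rewrite (reindex (@sum_dias_gen gamma)) ?big_sumType //.
exists (@dias_gen_sum gamma) => x _; last exact: dias_gen_sumK.
by case: x.
Qed.

(** Pairing with a left comb gives the coefficient, pairing with a right comb gives minus the
    coefficient; each spanning relator, a difference of a left and a right comb, therefore forces a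
    sum of two coefficients to vanish. *)
Lemma mem_dias_annihilator (v : free_operad K dgen 2%N) :
  v \in annihilator (dias_relations K gamma) <->
  forall a b,
  [/\ lft v (Dashv a) (Vdash b) = - rgt v (Vdash b) (Dashv a),
      rgt v (Dashv a) (Vdash b) = - lft v (Dashv a) (Dashv (Order.max a b)),
      lft v (Vdash a) (Dashv b) = - rgt v (Vdash a) (Vdash (Order.max a b)),
      rgt v (Dashv a) (Dashv b) = - lft v (Dashv (Order.max a b)) (Dashv a)
    & lft v (Vdash a) (Vdash b) = - rgt v (Vdash (Order.max a b)) (Vdash a)].
Proof.
have form_sub g h g' h' :
    koszul_form (comp1 K g h - comp2 K g' h') v = lft v g h + rgt v g' h'.
  rewrite -koszul_form_comp1 -[rgt v g' h']opprK -koszul_form_comp2.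
  exact: linB (koszul_form_linear v) _ _.
rewrite mem_annihilator; split=> [v0 a b|v0 u].
  have form0 i : (i < 5)%N -> koszul_form (dias_relators K a b)`_i v = 0.
    move=> lt_i5; apply: v0; apply: (subvP (sumv_sup a _ (subvv _))) => //.
    by apply: (subvP (sumv_sup b _ (subvv _))) => //; apply/memv_span/mem_nth.
  split; apply/eqP; rewrite -addr_eq0.
  - by have /= := form0 0%N isT; rewrite form_sub => /eqP.
  - by have /= := form0 1%N isT; rewrite form_sub addrC => /eqP.
  - by have /= := form0 2%N isT; rewrite form_sub => /eqP.
  - by have /= := form0 3%N isT; rewrite form_sub addrC => /eqP.
  - by have /= := form0 4%N isT; rewrite form_sub => /eqP.
(* The vectors orthogonal to [v] form a subspace, so it suffices to test the spanning relators. *)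
pose Z := span_of (fun u => koszul_form u v = 0).
have memZ u' : u' \in Z <-> koszul_form u' v = 0.
  apply: mem_span_of => [|a x y x0 y0]; first exact: lin0 (koszul_form_linear v).
  by rewrite (koszul_form_linear v) x0 y0 scaler0 addr0.
move=> Ru; apply/memZ; move: Ru; apply/subvP.
apply/subv_sumP => a _; apply/subv_sumP => b _; apply/span_subvP => w.
have [e1 e2 e3 e4 e5] := v0 a b.
rewrite !inE => /or4P[/eqP->|/eqP->|/eqP->|/orP[/eqP->|/eqP->]]; apply/memZ;
  rewrite form_sub.
- by rewrite e1 addNr.
- by rewrite e2 subrr.
- by rewrite e3 addNr.
- by rewrite e4 subrr.
- by rewrite e5 addNr.
Qed.

(** Differences of the two sides of the three families of relations of [Dendr], where [Dashv a] is
    [<_a] and [Vdash a] is [>_a]. *)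
Definition middle_relator a b : free_operad K dgen 2%N :=
  comp1 K (Dashv a) (Vdash b) - comp2 K (Vdash b) (Dashv a).
Definition left_relator a b : free_operad K dgen 2%N :=
  comp1 K (Dashv a) (Dashv b)
  - (\sum_(d | Order.max b d == a) comp2 K (Dashv b) (Dashv d)
     + \sum_(d | Order.max a d == b) comp2 K (Dashv a) (Vdash d)).
Definition right_relator a b : free_operad K dgen 2%N :=
  comp2 K (Vdash a) (Vdash b)
  - (\sum_(d | Order.max a d == b) comp1 K (Vdash a) (Dashv d)
     + \sum_(d | Order.max b d == a) comp1 K (Vdash b) (Vdash d)).

Lemma dias_gen_eqE :
  ((forall a b, (Dashv a == Dashv b) = (a == b))
   * (forall a b, (Vdash a == Vdash b) = (a == b))
   * (forall a b, (Dashv a == Vdash b) = false)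
   * (forall a b, (Vdash a == Dashv b) = false))%type.
Proof. by []. Qed.

Lemma sum_and_eq (P : pred label) (B : bool) (f : label -> dgen) c :
  injective f -> \sum_(d | P d) (B && (f c == f d))%:R = (B && P c)%:R :> K.
Proof.
move=> inj_f; rewrite big_mkcond (bigD1 c) //= eqxx andbT big1 => [|d ne_dc].
  by rewrite addr0 andbC; case: (P c).
by rewrite (inj_eq inj_f) eq_sym (negbTE ne_dc) andbF if_same.
Qed.

Lemma sum_and_neq (P : pred label) (B : bool) (f f' : label -> dgen) c :
  (forall d, f c == f' d = false) ->
  \sum_(d | P d) (B && (f c == f' d))%:R = 0 :> K.
Proof. by move=> neq; apply: big1 => d _; rewrite neq andbF. Qed.

Lemma sum_and_dias_genE (P : pred label) (B : bool) c :
  (\sum_(d | P d) (B && (Dashv c == Dashv d))%:R = (B && P c)%:R :> K)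
  * (\sum_(d | P d) (B && (Vdash c == Vdash d))%:R = (B && P c)%:R :> K)
  * (\sum_(d | P d) (B && (Dashv c == Vdash d))%:R = 0 :> K)
  * (\sum_(d | P d) (B && (Vdash c == Dashv d))%:R = 0 :> K).
Proof.
split; last exact: sum_and_neq; split; last exact: sum_and_neq.
by split; apply: sum_and_eq => x y [].
Qed.

Lemma sum_false_and (P Q : pred label) :
  \sum_(d | P d) (false && Q d)%:R = 0 :> K.
Proof. exact: big1. Qed.

Lemma middle_relator_mem a b :
  middle_relator a b \in annihilator (dias_relations K gamma).
Proof.
apply/mem_dias_annihilator => c e.
have lcoef g h : left_coef g h (middle_relator a b)
    = ((g == Dashv a) && (h == Vdash b))%:R - 0.
  apply: etrans (linB (left_coef_linear g h) _ _) _.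
  by congr (_ - _); [apply: left_coef_comp1|apply: left_coef_comp2].
have rcoef g h : right_coef g h (middle_relator a b)
    = 0 - ((g == Vdash b) && (h == Dashv a))%:R.
  apply: etrans (linB (right_coef_linear g h) _ _) _.
  by congr (_ - _); [apply: right_coef_comp1|apply: right_coef_comp2].
rewrite !lcoef !rcoef !dias_gen_eqE !subr0 !sub0r !andbF oppr0 opprK.
by split; rewrite ?oppr0 // andbC.
Qed.

Lemma left_relator_mem a b :
  left_relator a b \in annihilator (dias_relations K gamma).
Proof.
apply/mem_dias_annihilator => c e.
have lcoef g h : left_coef g h (left_relator a b)
    = ((g == Dashv a) && (h == Dashv b))%:R - (0 + 0).
  have lin := @left_coef_linear K dgen g h.
  apply: etrans (linB lin _ _) _; congr (_ - _); first exact: left_coef_comp1.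
  apply: etrans (linD lin _ _) _.
  by congr (_ + _); apply: etrans (lin_sum lin _ _ _) _; apply: big1 => d _;
    apply: left_coef_comp2.
have rcoef g h : right_coef g h (left_relator a b)
    = 0 - (\sum_(d | Order.max b d == a) ((g == Dashv b) && (h == Dashv d))%:R
         + \sum_(d | Order.max a d == b) ((g == Dashv a) && (h == Vdash d))%:R).
  have lin := @right_coef_linear K dgen g h.
  apply: etrans (linB lin _ _) _; congr (_ - _); first exact: right_coef_comp1.
  apply: etrans (linD lin _ _) _.
  by congr (_ + _); apply: etrans (lin_sum lin _ _ _) _; apply: eq_bigr => d _;
    apply: right_coef_comp2.
rewrite !lcoef !rcoef !dias_gen_eqE !sum_false_and.
rewrite !(sum_and_dias_genE _ _ e) ?andbF /=.
rewrite !(addr0, add0r, subr0, sub0r, oppr0, opprK).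
(* Two of the five conditions are nontrivial; their sides are indicators that agree once [c = a],
   respectively [c = b]. *)
split=> //; do 2?congr (- _); congr (nat_of_bool _)%:R.
  by case: eqP => // ->.
by rewrite [RHS]andbC; case: (c =P b) => // ->.
Qed.

Lemma right_relator_mem a b :
  right_relator a b \in annihilator (dias_relations K gamma).
Proof.
apply/mem_dias_annihilator => c e.
have rcoef g h : right_coef g h (right_relator a b)
    = ((g == Vdash a) && (h == Vdash b))%:R - (0 + 0).
  have lin := @right_coef_linear K dgen g h.
  apply: etrans (linB lin _ _) _; congr (_ - _); first exact: right_coef_comp2.
  apply: etrans (linD lin _ _) _.
  by congr (_ + _); apply: etrans (lin_sum lin _ _ _) _; apply: big1 => d _;
    apply: right_coef_comp1.
have lcoef g h : left_coef g h (right_relator a b)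
    = 0 - (\sum_(d | Order.max a d == b) ((g == Vdash a) && (h == Dashv d))%:R
         + \sum_(d | Order.max b d == a) ((g == Vdash b) && (h == Vdash d))%:R).
  have lin := @left_coef_linear K dgen g h.
  apply: etrans (linB lin _ _) _; congr (_ - _); first exact: left_coef_comp2.
  apply: etrans (linD lin _ _) _.
  by congr (_ + _); apply: etrans (lin_sum lin _ _ _) _; apply: eq_bigr => d _;
    apply: left_coef_comp1.
rewrite !lcoef !rcoef !dias_gen_eqE !sum_false_and.
rewrite !(sum_and_dias_genE _ _ e) ?andbF /=.
rewrite !(addr0, add0r, subr0, sub0r, oppr0, opprK).
split=> //; do 2?congr (- _); congr (nat_of_bool _)%:R.
  by case: eqP => // ->.
by rewrite [RHS]andbC; case: (c =P b) => // ->.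
Qed.

End KoszulDual.

(** * The annihilator acts by zero on algebras satisfying the relations *)

Section RelationsHold.
Variables (K : fieldType) (gamma : nat) (V : lmodType K).
Notation label := 'I_gamma.
Variables lt gt : label -> V -> V -> V.
Hypothesis lt_bil : forall a, bilinear_op (lt a).
Hypothesis gt_bil : forall a, bilinear_op (gt a).
Hypothesis lt_gt : forall a b x y z, lt a (gt b x y) z = gt b x (lt a y z).
Hypothesis lt_lt : forall a b x y z,
  lt a (lt b x y) z
  = \sum_(d | Order.max b d == a) lt b x (lt d y z)
    + \sum_(d | Order.max a d == b) lt a x (gt d y z).
Hypothesis gt_gt : forall a b x y z,
  gt a x (gt b y z)
  = \sum_(d | Order.max a d == b) gt a (lt d x y) z
    + \sum_(d | Order.max b d == a) gt b (gt d x y) z.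

Definition dendr_op (g : dias_gen gamma) : V -> V -> V :=
  match g with Dashv a => lt a | Vdash a => gt a end.

Lemma dendr_op_bil g : bilinear_op (dendr_op g).
Proof. by case: g. Qed.

(** Given [b] and [d], exactly one [a] satisfies the constraint. *)
Lemma sum_max_fiber (c : label -> label -> K) (F : label -> label -> V) :
  \sum_a \sum_b c a b *: (\sum_(d | Order.max b d == a) F b d)
  = \sum_b \sum_d c (Order.max b d) b *: F b d.
Proof.
rewrite exchange_big; apply: eq_bigr => b _ /=.
under eq_bigr => a _ do rewrite scaler_sumr.
rewrite (exchange_big_dep xpredT) //=; apply: eq_bigr => d _.
by rewrite (big_pred1 (Order.max b d)) // => a; rewrite eq_sym.
Qed.

Lemma sum_max_fiber_r (c : label -> label -> K) (F : label -> label -> V) :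
  \sum_a \sum_b c a b *: (\sum_(d | Order.max a d == b) F a d)
  = \sum_a \sum_d c a (Order.max a d) *: F a d.
Proof.
by rewrite exchange_big /=; apply: (sum_max_fiber (fun b a => c a b)).
Qed.

(** The three relations rewrite the value of any [v] in terms of five families of monomials, and the
    five conditions on the coefficients make each family cancel. *)
Lemma annihilator_identities :
  (annihilator (dias_relations K gamma) <= identities dendr_op 2)%VS.
Proof.
apply/subvP => v /mem_dias_annihilator rel_v; apply/mem_identities => X.
rewrite /free_eval sum_tree2.
pose x := X 0%N; pose y := X 1%N; pose z := X 2%N.
transitivity
  (\sum_g \sum_h left_coef g h v *: dendr_op g (dendr_op h x y) z
   + \sum_g \sum_h right_coef g h v *: dendr_op g x (dendr_op h y z)) => //.
rewrite !big_dias_gen.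
under eq_bigr => a _ do rewrite big_dias_gen.
under [X in _ + X + _ = _]eq_bigr => a _ do rewrite big_dias_gen.
under [X in _ + (X + _) = _]eq_bigr => a _ do rewrite big_dias_gen.
under [X in _ + (_ + X) = _]eq_bigr => a _ do rewrite big_dias_gen.
rewrite !big_split /=.
pose A a b := left_coef (Dashv a) (Vdash b) v.
pose B a b := left_coef (Dashv a) (Dashv b) v.
pose C a b := right_coef (Vdash a) (Vdash b) v.
pose S0 := \sum_a \sum_b A a b *: gt b x (lt a y z).
pose S1 := \sum_b \sum_d B (Order.max b d) b *: lt b x (lt d y z).
pose S2 := \sum_a \sum_d B a (Order.max a d) *: lt a x (gt d y z).
pose S3 := \sum_a \sum_d C a (Order.max a d) *: gt a (lt d x y) z.
pose S4 := \sum_b \sum_d C (Order.max b d) b *: gt b (gt d x y) z.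
have sum2N (p q : label -> label -> K) (F : label -> label -> V) :
    (forall a b, p a b = - q a b) ->
    \sum_a \sum_b p a b *: F a b = - \sum_a \sum_b q a b *: F a b.
  move=> pq; rewrite -sumrN; apply: eq_bigr => a _; rewrite -sumrN.
  by apply: eq_bigr => b _; rewrite pq scaleNr.
(* Eight blocks, left combs before right combs, ordered by the generators at the root and below it;
   each of the five sums occurs once with each sign. *)
transitivity ((S1 + S2 + S0) + (- S3 - S4) + ((- S1 - S2) + (- S0 + (S3 + S4)))).
  congr (_ + _ + (_ + _) + (_ + _ + (_ + _))).
  - rewrite /S1 /S2 -(sum_max_fiber B) -(sum_max_fiber_r B) -big_split.
    apply: eq_bigr => a _; rewrite -big_split; apply: eq_bigr => b _ /=.
    by rewrite -scalerDr lt_lt.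
  - by apply: eq_bigr => a _; apply: eq_bigr => b _; rewrite lt_gt.
  - by apply: sum2N => a b; have [] := rel_v a b.
  - by apply: sum2N => a b; have [] := rel_v a b.
  - by apply: sum2N => a b; have [] := rel_v a b.
  - by apply: sum2N => a b; have [] := rel_v a b.
  - rewrite /S0 exchange_big /=; apply: sum2N => a b.
    by have [] := rel_v a b; rewrite /A => -> _ _ _ _; rewrite opprK.
  rewrite /S3 /S4 -(sum_max_fiber C) -(sum_max_fiber_r C) -big_split.
  apply: eq_bigr => a _; rewrite -big_split; apply: eq_bigr => b _ /=.
  by rewrite -scalerDr gt_gt.
by apply/eqP; rewrite addr_eq0 !opprD !opprK -!addrA.
Qed.

End RelationsHold.

(** * Basis vectors indexed by trees of any size *)

Section TreeVectors.
Variables (K : fieldType) (G : finType).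
Implicit Types (t s : btree G).

(* The basis vector of t in arity [n + 1], and 0 when t has another arity; this
   avoids casts between equal arities. *)
Definition tree_vec n t : free_operad K G n :=
  ([ffun t' : tree G n => (val t' == t)%:R] : {ffun tree G n -> K^o}).

Lemma tree_vec_val n (t : tree G n) : tree_vec n (val t) = basis_tree K t.
Proof. by apply/ffunP => t'; rewrite !ffunE val_eqE. Qed.

Lemma tree_vec0 n t : nodes t != n -> tree_vec n t = 0.
Proof.
move=> /negbTE ne_n; apply/ffunP => t'; rewrite !ffunE; case: eqP => // def_t.
by rewrite -def_t (valP t') in ne_n.
Qed.

Lemma tree_vecP n t : nodes t = n -> exists t' : tree G n, t = val t'.
Proof. by move=> /eqP size_t; exists (Sub t size_t); rewrite SubK. Qed.

Lemma free_eval_tree_vec (V : lmodType K) (op : G -> V -> V -> V) n X t :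
  nodes t = n -> free_eval op X (tree_vec n t) = tree_eval op t X.
Proof.
by move=> /tree_vecP[t' ->]; rewrite tree_vec_val free_eval_basis.
Qed.

End TreeVectors.

(** * The index set of the basis, and a dimension bound by functionals *)

Section Index.
Variable gamma : nat.
Notation etree := (btree 'I_gamma).

(** The nonempty edge-labelled trees with [n + 1] nodes, each given by the two subtrees of its root;
    they index a basis in arity [n + 1]. *)
Definition split_tree n :=
  {i : 'I_n.+1 & (tree 'I_gamma i * tree 'I_gamma (n - i))%type}.
Definition left_tree n (p : split_tree n) : etree := val (tagged p).1.
Definition right_tree n (p : split_tree n) : etree := val (tagged p).2.

Lemma split_treeP n (l r : etree) : (nodes l + nodes r)%N = n ->
  exists p : split_tree n, l = left_tree p /\ r = right_tree p.
Proof.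
move=> def_n; have lt_i : (nodes l < n.+1)%N by rewrite ltnS -def_n leq_addr.
pose i := Ordinal lt_i.
have size_l : nodes l == i by [].
have size_r : nodes r == (n - i)%N by rewrite /= -def_n addKn.
exists (@Tagged _ i _ (Sub l size_l : tree _ i, Sub r size_r : tree _ (n - i)%N)).
by [].
Qed.

Lemma nodes_split_tree n (p : split_tree n) :
  (nodes (left_tree p) + nodes (right_tree p))%N = n.
Proof.
case: p => i [l r]; rewrite /left_tree /right_tree /=.
by rewrite (eqP (valP l)) (eqP (valP r)) subnKC // -ltnS.
Qed.

Lemma split_tree_inj n (p q : split_tree n) :
  left_tree p = left_tree q -> right_tree p = right_tree q -> p = q.
Proof.
case: p q => i [l r] [j [l' r']]; rewrite /left_tree /right_tree /= => eq_l eq_r.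
have eq_ij : i = j.
  apply: val_inj; apply: etrans (etrans (congr1 (@nodes _) eq_l) (eqP (valP l'))).
  exact: esym (eqP (valP l)).
by subst j; rewrite (val_inj eq_l) (val_inj eq_r).
Qed.

End Index.

(** The dual vectors make the functionals jointly surjective onto the functions on [I], and the
    kernel of this map contains [Z]. *)
Lemma dim_add_card (K : fieldType) (V : vectType K) (I : finType)
    (phi : I -> V -> K^o) (Z : {vspace V}) :
  (forall i, linear (phi i)) -> (forall i x, x \in Z -> phi i x = 0) ->
  (forall i, exists x, forall j, phi j x = (j == i)%:R) ->
  (\dim Z + #|I| <= \dim {:V})%N.
Proof.
move=> lin_phi phi0 dual.
pose f x : {ffun I -> K^o} := [ffun i => phi i x].
have f_linear : linear f.
  by move=> k x y; apply/ffunP => i; rewrite !ffunE lin_phi.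
pose F : {linear V -> {ffun I -> K^o}} :=
  HB.pack f (GRing.isLinear.Build _ _ _ _ f f_linear).
have FE x : linfun F x = f x by rewrite lfunE.
have limg_F : limg (linfun F) = fullv.
  apply/eqP; rewrite eqEsubv subvf; apply/subvP => w _.
  have -> : w = \sum_i w i *: ([ffun j => (j == i)%:R] : {ffun I -> K^o}).
    apply/ffunP => i; rewrite sum_ffunE (bigD1 i) //= !ffunE eqxx big1 => [|j ne_ji].
      by rewrite addr0 [_ *: _]mulr1.
    by rewrite !ffunE eq_sym (negbTE ne_ji) scaler0.
  apply: memv_suml => i _; apply: memvZ; apply/memv_imgP.
  have [x def_x] := dual i; exists x; first exact: memvf.
  by rewrite FE; apply/ffunP => j; rewrite !ffunE def_x.
have Z_ker : (Z <= lker (linfun F))%VS.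
  apply/subvP => x Zx; rewrite memv_ker FE.
  by apply/eqP/ffunP => i; rewrite !ffunE phi0.
rewrite -(limg_ker_dim (linfun F) fullv) limg_F capfv leq_add ?dimvS //.
by rewrite dimvf /dim /= muln1.
Qed.

(** * Lower bound: evaluation in the model *)

Section LowerBound.
Variables (K : fieldType) (gamma : nat).
Notation label := 'I_gamma.
Notation etree := (btree label).
Notation model := (etree -> etree -> K^o).
Notation dgen := (dias_gen gamma).
Implicit Types (a b c d : label) (l r : etree).

Definition model_op : dgen -> model -> model -> model :=
  dendr_op (lt_op (@pre K gamma)) (gt_op (@suc K gamma)).

Lemma model_op_bil g : bilinear_op (model_op g).
Proof.
apply: dendr_op_bil => a; first exact/lt_op_bil/pre_bil.
exact/gt_op_bil/suc_bil.
Qed.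

Lemma annihilator_model_identities :
  (annihilator (dias_relations K gamma) <= identities model_op 2)%VS.
Proof.
have [pB sB] := (@pre_bil K gamma, @suc_bil K gamma).
have [[sp pp] ss] := (@suc_pre K gamma, @pre_pre K gamma, @suc_suc K gamma).
apply: annihilator_identities => *.
- exact: lt_gt_op.
- exact: lt_lt_op.
- exact: gt_gt_op.
Qed.

Definition delta l r : model := fun l' r' => ((l' == l) && (r' == r))%:R.

Lemma eq_Node a b l r l' r' :
  (Node a l r == Node b l' r') = [&& a == b, l == l' & r == r'].
Proof.
by apply/eqP/and3P => [[-> -> ->]|[/eqP-> /eqP-> /eqP->]].
Qed.

(** With an empty right subtree the recursive terms vanish and the second factor is simply attached
    by a new edge. Products of this kind, and their mirror images, build every tree. *)
Lemma pre_delta a l r1 r2 :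
  pre a (delta l Leaf) (delta r1 r2) = delta l (Node a r1 r2).
Proof.
apply: funext => l'; apply: funext => -[|c u v]; first by rewrite /delta andbF.
have right0 b : right_part b l' (delta l Leaf) = 0.
  by apply: funext => ?; apply: funext => ?; rewrite /right_part /delta andbF.
rewrite pre_Node big1 => [|b _]; last by rewrite right0 (bil0l (star_bil _ _ _)).
rewrite addr0 /delta eq_Node eqxx andbT.
by case: (l' == l); case: (c == a); rewrite ?mul0r ?mulr0 ?mul1r.
Qed.

Lemma suc_delta a l1 l2 r :
  suc a (delta l1 l2) (delta Leaf r) = delta (Node a l1 l2) r.
Proof.
apply: funext => -[|c u v]; apply: funext => r'; first by [].
have left0 b : left_part b r' (delta Leaf r) = 0.
  by apply: funext => ?; apply: funext => ?; rewrite /left_part /delta.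
rewrite suc_Node big1 => [|b _]; last by rewrite left0 (bil0r (star_bil _ _ _)).
rewrite addr0 /delta eq_Node eqxx /=.
by case: (r' == r); case: (c == a); rewrite ?mul0r ?mulr0 ?mul1r ?mulr1 ?andbT ?andbF.
Qed.

(** Every input is the one-node tree, coded by two empty subtrees. *)
Definition ev n : free_operad K dgen n -> model :=
  free_eval model_op (fun=> delta Leaf Leaf) (n := n).

Lemma ev_linear n : linear (@ev n).
Proof. exact: free_eval_linear. Qed.

Definition attained n (f : model) := exists x, @ev n x = f.

Lemma attained_op n m g f f' :
  attained n f -> attained m f' -> attained (n + m).+1 (model_op g f f').
Proof.
move=> [x <-] [y <-].
(* The generator [g] with [x] and [y] grafted on its two leaves, expanded over trees. *)
exists (\sum_(t : tree dgen n) \sum_(s : tree dgen m)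
  ((x : free_space K dgen n) t * (y : free_space K dgen m) s)
    *: tree_vec K (n + m).+1 (Node g (val t) (val s))).
rewrite (lin_sum (@ev_linear _)) {2}/ev /free_eval (bil_suml (model_op_bil g)).
apply: eq_bigr => t _; rewrite (lin_sum (@ev_linear _)).
rewrite (bilZl (model_op_bil g)) {2}/ev /free_eval (bil_sumr (model_op_bil g)).
rewrite scaler_sumr; apply: eq_bigr => s _.
rewrite (linZ (@ev_linear _)) (bilZr (model_op_bil g)) scalerA; congr (_ *: _).
by rewrite /ev free_eval_tree_vec //= (eqP (valP t)) (eqP (valP s)).
Qed.

Lemma attained_sum n I (r : seq I) (P : pred I) (F : I -> model) :
  (forall i, P i -> attained n (F i)) -> attained n (\sum_(i <- r | P i) F i).
Proof.
apply: big_ind => [|f f' [x <-] [y <-]].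
  by exists 0; apply: lin0 (@ev_linear n).
by exists (x + y); rewrite (linD (@ev_linear n)).
Qed.

(** Induction on the size: the right subtree, or the left one when the right is empty, is split off
    by [pre] or [suc], which are sums of the generating operations. *)
Lemma attained_delta l r : attained (nodes l + nodes r) (delta l r).
Proof.
have [k] := ubnP (nodes l + nodes r); elim: k l r => // k IHk l [|a r1 r2].
  case: l => [|b l1 l2] /= lt_k.
    by exists (tree_vec K 0 Leaf); rewrite /ev free_eval_tree_vec.
  rewrite -suc_delta -sum_gt_op; apply: attained_sum => d _.
  rewrite addn0 -[(nodes l1 + nodes l2)%N]addn0.
  apply: (attained_op (Vdash d)); first by apply: IHk; rewrite addn0 in lt_k.
  by apply: (IHk Leaf Leaf); move: lt_k; rewrite addn0 ltnS; apply: leq_trans.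
rewrite /= => lt_k; rewrite -pre_delta -sum_lt_op; apply: attained_sum => d _.
rewrite addnS -[nodes l]addn0.
apply: (attained_op (Dashv d)).
  apply: (IHk l Leaf); move: lt_k; rewrite ltnS; apply: leq_trans.
  by rewrite /= addn0 addnS ltnS leq_addr.
apply: (IHk r1 r2); move: lt_k; rewrite ltnS; apply: leq_trans.
by rewrite addnS ltnS leq_addl.
Qed.

(** The coefficients of [ev x] are functionals of [x] that vanish on the ideal, because the
    relations hold in the model; [attained_delta] provides the dual vectors. *)
Lemma dim_relations_ub n :
  (\dim (gen_ideal (annihilator (dias_relations K gamma)) n)
   + #|{: split_tree gamma n}| <= \dim {: free_operad K dgen n})%N.
Proof.
pose phi (p : split_tree gamma n) (x : free_operad K dgen n) : K^o :=
  ev x (left_tree p) (right_tree p).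
apply: (@dim_add_card _ _ _ phi) => [p k x y|p x|p].
- by rewrite /phi ev_linear.
- move=> /mem_gen_ideal /(_ _ (identities_ideal model_op_bil)).
  by move=> /(_ annihilator_model_identities) /mem_identities x0; rewrite /phi /ev x0.
have := attained_delta (left_tree p) (right_tree p).
rewrite nodes_split_tree => -[x def_x]; exists x => q; rewrite /phi def_x /delta.
congr (nat_of_bool _)%:R; apply/andP/eqP => [[/eqP el /eqP er]|-> //].
exact: split_tree_inj.
Qed.

End LowerBound.

(** * Rewriting trees modulo an ideal of relations *)

Lemma linear_span_of (K : fieldType) (V W : vectType K) (f : V -> W)
    (P : V -> Prop) (U : {vspace W}) v : linear f ->
  (forall u, P u -> f u \in U) -> v \in span_of P -> f v \in U.
Proof.
move=> lin_f PU Pv.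
pose Z := span_of (fun u => f u \in U).
have memZ u : u \in Z <-> f u \in U.
  apply: mem_span_of => [|a x y fx fy]; first by rewrite (lin0 lin_f) mem0v.
  by rewrite lin_f memvD ?memvZ.
apply/memZ; apply: (subvP _ _ Pv); apply: span_of_min => u Pu.
by apply/memZ/PU.
Qed.

Section Rewriting.
Variables (K : fieldType) (G : finType) (R : {vspace free_operad K G 2%N}).
Implicit Types (t s x y z : btree G) (g h : G).
Notation I := (gen_ideal R).
Notation vec := (tree_vec K).

Lemma free_comp_sumZl n m i J (r : seq J) (c : J -> K)
    (u : J -> free_space K G n) (w : free_space K G m) :
  free_comp i (\sum_(j <- r) c j *: u j) w = \sum_(j <- r) c j *: free_comp i (u j) w.
Proof.
have lin : linear (fun u' : free_space K G n => free_comp i u' w).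
  exact: free_compl_linear.
apply: etrans (lin_sum lin _ _ _) _; apply: eq_bigr => j _; exact: linZ lin _ _.
Qed.

Lemma free_comp_vec n m i t s : nodes t = n -> nodes s = m ->
  free_comp i (vec n t : free_space K G n) (vec m s : free_space K G m)
  = vec (n + m) (graft i t s).
Proof.
move=> /tree_vecP[t' ->] /tree_vecP[s' ->].
by rewrite !tree_vec_val free_comp_basis -tree_vec_val.
Qed.

(** The leaves are filled from right to left, so that the numbers of those still to be filled do not
    change. *)
Definition substitute t x y z := graft 0 (graft 1 (graft 2 t z) y) x.

Definition substitution N x y z (v : free_operad K G 2%N) : free_operad K G N :=
  \sum_t (v : free_space K G 2) t *: vec N (substitute (val t) x y z).

Lemma substitution_linear N x y z : linear (@substitution N x y z).
Proof.
move=> a u v; rewrite /substitution scaler_sumr -big_split; apply: eq_bigr => t _.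
by rewrite !ffunE /= scalerDl scalerA.
Qed.

Lemma substitution_basis N x y z (t : tree G 2) :
  substitution N x y z (basis_tree K t) = vec N (substitute (val t) x y z).
Proof.
rewrite /substitution (bigD1 t) //= big1 => [|s /negbTE ne].
  by rewrite ffunE eqxx scale1r addr0.
by rewrite ffunE ne scale0r.
Qed.

Lemma substitution_comp1 N x y z g h :
  substitution N x y z (comp1 K g h) = vec N (Node g (Node h x y) z).
Proof. by rewrite comp1E substitution_basis. Qed.

Lemma substitution_comp2 N x y z g h :
  substitution N x y z (comp2 K g h) = vec N (Node g x (Node h y z)).
Proof. by rewrite comp2E substitution_basis. Qed.

Lemma substitution_mem N x y z v : v \in R -> substitution N x y z v \in I N.
Proof.
move=> Rv; have size_sub (t : tree G 2) :
    nodes (substitute (val t) x y z) = (2 + nodes z + nodes y + nodes x)%N.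
  by rewrite /substitute !nodes_graft (eqP (valP t)).
have [-> |/eqP ne_N] := eqVneq N (2 + nodes z + nodes y + nodes x)%N; last first.
  rewrite /substitution big1 ?mem0v // => t _.
  by rewrite tree_vec0 ?scaler0 // size_sub eq_sym; apply/eqP.
have idI := gen_ideal_is_ideal R.
have Iv : v \in I 2 by apply: (subvP (gen_ideal_sub R)).
have I1 := (idI 2%N (nodes z) 2%N v (vec _ z) isT).1 Iv.
have I2 := (idI (2 + nodes z)%N (nodes y) 1%N _ (vec _ y) isT).1 I1.
have I0 := (idI (2 + nodes z + nodes y)%N (nodes x) 0%N _ (vec _ x) isT).1 I2.
move: I0; set w := op_comp _ _ _ _; suff -> : w = substitution _ x y z v by [].
rewrite /w {1}[v]free_decomp /substitution /=.
rewrite !free_comp_sumZl; apply: eq_bigr => t _.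
congr (_ *: _).
by rewrite -tree_vec_val !free_comp_vec // ?nodes_graft ?(eqP (valP t)).
Qed.

(** The vectors congruent, modulo the ideal, to a combination of trees satisfying [A]. *)
Definition span_mod (A : btree G -> Prop) N : {vspace free_operad K G N} :=
  span_of (fun w => w \in I N \/ exists2 t, A t & w = vec N t).

Definition reducible (A : btree G -> Prop) t := forall N, vec N t \in span_mod A N.

Lemma ideal_span_mod A N w : w \in I N -> w \in span_mod A N.
Proof. by move=> Iw; apply: sub_span_of; left. Qed.

Lemma reducible_refl (A : btree G -> Prop) t : A t -> reducible A t.
Proof. by move=> At N; apply: sub_span_of; right; exists t. Qed.

Lemma reducible_trans (A B : btree G -> Prop) t :
  (forall s, A s -> reducible B s) -> reducible A t -> reducible B t.
Proof.
move=> AB At N; apply: (subvP _ _ (At N)); apply: span_of_min => w [Iw|[s As ->]].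
  exact: ideal_span_mod.
exact: AB.
Qed.

(** Reductions may be carried out inside both subtrees, since attaching them to a node is bilinear
    and maps the ideal into itself. *)
Lemma reducible_Node (A B C : btree G -> Prop) g t s :
  (forall t' s', A t' -> B s' -> reducible C (Node g t' s')) ->
  reducible A t -> reducible B s -> reducible C (Node g t s).
Proof.
move=> ABC At Bs N; pose n := nodes t; pose m := nodes s.
have [-> |/eqP ne_N] := eqVneq N (1 + m + n)%N; last first.
  rewrite tree_vec0 ?mem0v //=; apply/eqP => def_N.
  by rewrite -def_N /m /n add1n addSn addnC in ne_N.
(* The second input is filled first, which keeps the first one numbered 0 and produces the arity
   index [1 + m + n]. *)
pose node (x : free_operad K G n) (y : free_operad K G m) :
    free_operad K G (1 + m + n) :=
  op_comp (free_operad K G) 0 (op_comp (free_operad K G) 1 (gen K g) y) x.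
have node_linl (y : free_operad K G m) : linear (node^~ y) by exact: free_compr_linear.
have node_linr (x : free_operad K G n) : linear (node x).
  by move=> k u v; rewrite /node /= free_compr_linear free_compl_linear.
have idI := gen_ideal_is_ideal R.
have node_vec t' s' : nodes t' = n -> nodes s' = m ->
    node (vec n t') (vec m s') = vec (1 + m + n) (Node g t' s').
  move=> def_n def_m; rewrite /node /= /gen -tree_vec_val.
  by rewrite !free_comp_vec ?nodes_graft //= def_m.
have node_mem (x : free_operad K G n) (y : free_operad K G m) :
    x \in span_mod A n -> y \in span_mod B m ->
    node x y \in span_mod C (1 + m + n).
  move=> Ax By; apply: (linear_span_of (node_linl y) _ Ax) => {Ax}x Ax.
  apply: (linear_span_of (node_linr x) _ By) => {By}y By.
  case: Ax => [Ix|[t' At' ->]].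
    by apply: ideal_span_mod; apply: (idI _ _ _ _ _ _).2.
  case: By => [Iy|[s' Bs' ->]].
    apply: ideal_span_mod; apply: (idI _ _ _ _ _ _).1 => //.
    by apply: (idI _ _ _ _ _ _).2.
  have [def_n|ne_n] := eqVneq (nodes t') n; last first.
    by rewrite tree_vec0 // (lin0 (node_linl _)) mem0v.
  have [def_m|ne_m] := eqVneq (nodes s') m; last first.
    by rewrite [vec m s']tree_vec0 // (lin0 (node_linr _)) mem0v.
  rewrite node_vec //; exact: ABC.
by rewrite -node_vec //; apply: node_mem.
Qed.

End Rewriting.

(** * Upper bound: reduction to normal trees *)

Lemma memv_of_sub (K : fieldType) (V : vectType K) (U : {vspace V}) u w :
  u - w \in U -> w \in U -> u \in U.
Proof. by move=> Uuw Uw; rewrite -(subrK w u) memvD. Qed.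

Section UpperBound.
Variables (K : fieldType) (gamma : nat).
Notation label := 'I_gamma.
Notation etree := (btree label).
Notation dgen := (dias_gen gamma).
Notation R := (annihilator (dias_relations K gamma)).
Notation vec := (tree_vec K).
Notation red := (reducible R).
Implicit Types (a b c d : label) (x y z : btree dgen) (A : btree dgen -> Prop).

(** This lemma and the next two turn the relations into rewriting rules at the root of a tree. *)
Lemma reducible_middle A a b x y z :
  red A (Node (Vdash b) x (Node (Dashv a) y z)) ->
  red A (Node (Dashv a) (Node (Vdash b) x y) z).
Proof.
move=> redA N; have := substitution_mem N x y z (middle_relator_mem K a b).
have -> : substitution N x y z (middle_relator K a b)
    = vec N (Node (Dashv a) (Node (Vdash b) x y) z)
      - vec N (Node (Vdash b) x (Node (Dashv a) y z)).
  apply: etrans (linB (@substitution_linear _ _ N x y z) _ _) _.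
  by congr (_ - _); [apply: substitution_comp1|apply: substitution_comp2].
by move=> /(ideal_span_mod A) /memv_of_sub; apply; apply: redA.
Qed.

Lemma reducible_left A a b x y z :
  (forall d, red A (Node (Dashv b) x (Node (Dashv d) y z))) ->
  (forall d, red A (Node (Dashv a) x (Node (Vdash d) y z))) ->
  red A (Node (Dashv a) (Node (Dashv b) x y) z).
Proof.
move=> redA redA' N; have := substitution_mem N x y z (left_relator_mem K a b).
have lin := @substitution_linear K dgen N x y z.
have -> : substitution N x y z (left_relator K a b)
    = vec N (Node (Dashv a) (Node (Dashv b) x y) z)
      - (\sum_(d | Order.max b d == a)
             vec N (Node (Dashv b) x (Node (Dashv d) y z))
         + \sum_(d | Order.max a d == b)
             vec N (Node (Dashv a) x (Node (Vdash d) y z))).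
  apply: etrans (linB lin _ _) _.
  congr (_ - _); first exact: substitution_comp1.
  apply: etrans (linD lin _ _) _.
  by congr (_ + _); apply: etrans (lin_sum lin _ _ _) _; apply: eq_bigr => d _;
    apply: substitution_comp2.
move=> /(ideal_span_mod A) /memv_of_sub; apply.
by rewrite memvD // memv_suml // => d _; [apply: redA|apply: redA'].
Qed.

Lemma reducible_right A a b x y z :
  (forall d, red A (Node (Vdash a) (Node (Dashv d) x y) z)) ->
  (forall d, red A (Node (Vdash b) (Node (Vdash d) x y) z)) ->
  red A (Node (Vdash a) x (Node (Vdash b) y z)).
Proof.
move=> redA redA' N; have := substitution_mem N x y z (right_relator_mem K a b).
have lin := @substitution_linear K dgen N x y z.
have -> : substitution N x y z (right_relator K a b)
    = vec N (Node (Vdash a) x (Node (Vdash b) y z))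
      - (\sum_(d | Order.max a d == b)
             vec N (Node (Vdash a) (Node (Dashv d) x y) z)
         + \sum_(d | Order.max b d == a)
             vec N (Node (Vdash b) (Node (Vdash d) x y) z)).
  apply: etrans (linB lin _ _) _.
  congr (_ - _); first exact: substitution_comp2.
  apply: etrans (linD lin _ _) _.
  by congr (_ + _); apply: etrans (lin_sum lin _ _ _) _; apply: eq_bigr => d _;
    apply: substitution_comp1.
move=> /(ideal_span_mod A) /memv_of_sub; apply.
by rewrite memvD // memv_suml // => d _; [apply: redA|apply: redA'].
Qed.

(* The irreducible trees for the relations oriented as in the three lemmas
   above: the left subtree of a node Dashv a is a leaf, and the root of the
   right subtree of a node Vdash a is not of the form Vdash b. *)
Fixpoint vdash_tree (l : etree) (m : btree dgen) : btree dgen :=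
  if l is Node b l1 l2 then Node (Vdash b) (vdash_tree l1 (dashv_tree l2)) m
  else m
with dashv_tree (r : etree) : btree dgen :=
  if r is Node a r1 r2 then Node (Dashv a) Leaf (vdash_tree r1 (dashv_tree r2))
  else Leaf.

(** For [l = Node b l1 l2] and [r = Node a r1 r2] this is [N1 >_b (x <_a N2)], with [x] a leaf and
    [N1], [N2] the normal trees of [(l1, l2)] and [(r1, r2)]. *)
Definition normal_tree l r := vdash_tree l (dashv_tree r).

Definition normal x := exists l r, x = normal_tree l r.
Definition normal_dashv x := exists r, x = dashv_tree r.

Lemma nodes_vdash_dashv (u : etree) :
  (forall m, nodes (vdash_tree u m) = (nodes u + nodes m)%N)
  /\ nodes (dashv_tree u) = nodes u.
Proof.
elim: u => [|a u [IHu _] v [IHv IHv']] //=; split=> [m|].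
  by rewrite IHu IHv'.
by rewrite IHu IHv'.
Qed.

Lemma nodes_normal_tree l r :
  nodes (normal_tree l r) = (nodes l + nodes r)%N.
Proof.
by rewrite /normal_tree (nodes_vdash_dashv l).1 (nodes_vdash_dashv r).2.
Qed.

Lemma reducible_dashv x : red normal_dashv x -> red normal x.
Proof.
apply: reducible_trans => _ [r ->]; apply: reducible_refl.
by exists Leaf, r.
Qed.

Lemma reducible_Node_normal g :
  (forall l r l' r', red normal (Node g (normal_tree l r) (normal_tree l' r'))) ->
  forall x y, red normal x -> red normal y -> red normal (Node g x y).
Proof.
move=> h x y; apply: reducible_Node => _ _ [l [r ->]] [l' [r' ->]]; exact: h.
Qed.

Lemma reducible_Dashv_Leaf a y :
  red normal y -> red normal_dashv (Node (Dashv a) Leaf y).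
Proof.
apply: (@reducible_Node _ _ _ (eq Leaf)); last exact: reducible_refl.
move=> _ _ <- [l [r ->]]; apply: reducible_refl.
by exists (Node a l r).
Qed.

Lemma reducible_Vdash a x y :
  red normal x -> red normal_dashv y -> red normal (Node (Vdash a) x y).
Proof.
apply: reducible_Node => _ _ [l [r ->]] [r' ->]; apply: reducible_refl.
by exists (Node a l r), r'.
Qed.

(** Induction on the total size: after one or two rewriting steps at the root, the only products
    left to reduce are products of smaller normal trees. *)
Lemma reducible_normal_product a l r l' r' :
  red normal (Node (Dashv a) (normal_tree l r) (normal_tree l' r'))
  /\ red normal (Node (Vdash a) (normal_tree l r) (normal_tree l' r')).
Proof.
have [k] := ubnP ((nodes l + nodes r) + (nodes l' + nodes r')).
elim: k a l r l' r' => // k IHk a l r l' r' lt_k.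
have normal_red u v : red normal (normal_tree u v).
  by apply: reducible_refl; exists u, v.
have dashv_red u : red normal_dashv (dashv_tree u).
  by apply: reducible_refl; exists u.
split.
  (* First the case of an empty [l]; when [l] is nonempty, the middle rule moves [Dashv a] below the
     root [Vdash b] and leads back to this case. *)
  have dashvP : red normal_dashv (Node (Dashv a) (dashv_tree r) (normal_tree l' r')).
    case: r lt_k => [|b r1 r2] lt_k /=; first exact: reducible_Dashv_Leaf.
    have lt_k' : ((nodes r1 + nodes r2) + (nodes l' + nodes r') < k)%N.
      move: lt_k; rewrite ltnS; apply: leq_trans.
      by rewrite /= addnS ltnS leq_add2r leq_addl.
    apply: reducible_left => d; apply: reducible_Dashv_Leaf.
      exact: (IHk d r1 r2 l' r' lt_k').1.
    exact: (IHk d r1 r2 l' r' lt_k').2.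
  case: l {lt_k} => [|b l1 l2]; first exact: reducible_dashv.
  by apply: reducible_middle; apply: reducible_Vdash; first exact: normal_red.
case: l' lt_k => [|b l1 l2] lt_k; first exact: reducible_Vdash.
have lt_k' : ((nodes l + nodes r) + (nodes l1 + nodes l2) < k)%N.
  move: lt_k; rewrite ltnS; apply: leq_trans.
  by rewrite /= addSn addnS ltnS leq_add2l leq_addr.
apply: reducible_right => d; apply: reducible_Vdash (dashv_red r').
  exact: (IHk d l r l1 l2 lt_k').1.
exact: (IHk d l r l1 l2 lt_k').2.
Qed.

Lemma reducible_all x : red normal x.
Proof.
elim: x => [|g x IHx y IHy]; first by apply: reducible_refl; exists Leaf, Leaf.
apply: reducible_Node_normal IHx IHy => l r l' r'.
by case: g => a; have [] := reducible_normal_product a l r l' r'.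
Qed.

(** Modulo the ideal, arity [n + 1] is spanned by the normal trees with [n] nodes, which are indexed
    by [split_tree]. *)
Lemma dim_relations_lb n :
  (\dim {: free_operad K dgen n}
   <= \dim (gen_ideal R n) + #|{: split_tree gamma n}|)%N.
Proof.
pose S := [seq vec n (normal_tree (left_tree p) (right_tree p)) | p : split_tree gamma n].
have sub_S : (fullv <= gen_ideal R n + <<S>>)%VS.
  apply/subvP => w _; rewrite [w]free_decomp.
  apply: memv_suml => t _; apply: memvZ; rewrite -tree_vec_val.
  apply: (subvP _ _ (reducible_all (val t) n)).
  apply: span_of_min => u [Iw|[_ [l [r ->]] ->]].
    exact: (subvP (addvSl _ _)).
  have [def_n|ne_n] := eqVneq (nodes (normal_tree l r)) n; last first.
    by rewrite tree_vec0 ?mem0v.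
  move: def_n; rewrite nodes_normal_tree => /split_treeP[p [-> ->]].
  by apply: (subvP (addvSr _ _)); apply: memv_span; apply: image_f.
apply: leq_trans (dimvS sub_S) _.
apply: leq_trans (dimv_add_leqif _ _).1 _ => /=.
by rewrite leq_add2l (leq_trans (dim_span _)) // size_map -cardE.
Qed.

End UpperBound.

(** * Dimensions of [Dendr] and the equation of its Hilbert series *)

Lemma dim_quotv (K : fieldType) (V : vectType K) (U : {vspace V}) :
  \dim {: quotv U} = (\dim {:V} - \dim U)%N.
Proof. by rewrite dimvf -dimv_compl. Qed.

Lemma dim_Dendr (K : fieldType) (gamma n : nat) :
  \dim {: Dendr K gamma n} = #|{: split_tree gamma n}|.
Proof.
rewrite dim_quotv; apply/eqP; rewrite eqn_leq leq_subLR dim_relations_lb /=.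
by rewrite -(leq_add2l (\dim (gen_ideal (annihilator (dias_relations K gamma)) n)))
  subnKC ?dim_relations_ub // dimvS ?subvf.
Qed.

Lemma card_split_tree gamma n :
  #|{: split_tree gamma n}|
  = (\sum_(i < n.+1) #|{: tree 'I_gamma i}| * #|{: tree 'I_gamma (n - i)}|)%N.
Proof.
rewrite card_tagged sumnE big_map big_enum /=; apply: eq_bigr => i _.
by rewrite card_prod.
Qed.

Lemma card_tree0 (G : finType) : #|{: tree G 0}| = 1%N.
Proof.
apply/eqP/fintype1P; exists (exist (fun t => nodes t == 0)%N Leaf (eqxx 0%N)).
by move=> [[|//] size_t]; apply: val_inj.
Qed.

(** A nonempty tree amounts to the label of its root and the pair of its subtrees. *)
Lemma card_treeS gamma n :
  #|{: tree 'I_gamma n.+1}| = (gamma * #|{: split_tree gamma n}|)%N.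
Proof.
pose f (x : 'I_gamma * split_tree gamma n) := Node x.1 (left_tree x.2) (right_tree x.2).
have size_f x : nodes (f x) == n.+1 by rewrite /= nodes_split_tree.
pose F x : tree 'I_gamma n.+1 := Sub (f x) (size_f x).
have F_inj : injective F.
  move=> [a p] [b q] /(congr1 val) [/= -> eq_l eq_r].
  by rewrite (split_tree_inj eq_l eq_r).
have F_surj t : exists x, F x = t.
  case: t => -[|a l r] //= size_t; have size_lr := size_t.
  move: size_lr; rewrite eqSS => /eqP/split_treeP[p [def_l def_r]].
  by exists (a, p); apply: val_inj; rewrite /= def_l def_r.
have [G FG] := fin_all_exists F_surj.
rewrite -(@bij_eq_card _ _ F); first by rewrite card_prod card_ord.
by exists G => // x; apply: F_inj.
Qed.

Lemma fps_mul_const_t (c : int) (A : fps) n :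
  (c%:S * 't * A)%fps n = if n is m.+1 then c * A m else 0.
Proof.
have const_t i : (c%:S * 't)%fps i = c * (i == 1%N)%:R.
  rewrite /fps_mul big_ord_recl big1 => [|j _]; last by rewrite mul0r.
  by rewrite addr0 subn0.
rewrite {1}/fps_mul; case: n => [|m].
  by rewrite big_ord1 const_t mulr0 mul0r.
rewrite big_ord_recl const_t mulr0 mul0r add0r big_ord_recl const_t mulr1.
rewrite subSS subn0 big1 ?addr0 // => j _.
by rewrite const_t mulr0 mul0r.
Qed.

(* With E = 1 + gamma H, the series counting the pairs of subtrees is E^2. *)
Lemma coef_square (c : int) (H E : nat -> int) n :
  (forall i, E i = (i == 0%N)%:R + c * H i) -> H 0%N = 0 ->
  \sum_(i < n.+1) E i * E (n - i)%N
  = (n == 0%N)%:R + 2 * c * H n + c ^+ 2 * fps_mul H H n.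
Proof.
move=> defE H0.
under eq_bigr => i _ do rewrite !defE mulrDl !mulrDr.
rewrite !big_split /=.
rewrite big_ord_recl subn0 eqxx mul1r big1 ?addr0; last by move=> *; rewrite mul0r.
rewrite big_ord_recl subn0 mul1r big1 ?addr0; last by move=> *; rewrite mul0r.
rewrite big_ord_recr /= subnn mulr1 big1 ?add0r => [|i _]; last first.
  by rewrite subn_eq0 leqNgt ltn_ord mulr0.
have -> : \sum_(i < n.+1) c * H i * (c * H (n - i)%N) = c ^+ 2 * fps_mul H H n.
  by rewrite mulr_sumr; apply: eq_bigr => i _; ring.
by ring.
Qed.

Theorem proposition4p1p2 (K : fieldType) (charK0 : [pchar K]%R =i pred0)
    (gamma : nat) :
  let H := hilbert (Dendr K gamma) in
  (H =1 't + (2 * gamma%:Z)%R%:S * 't * H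
           + (gamma%:Z ^+ 2)%R%:S * 't * (H * H))%fps.
Proof.
move=> H n; rewrite /fps_add !fps_mul_const_t.
case: n => [|n]; first by rewrite /fps_t !addr0.
(* The coefficients of [1 + gamma H]: possibly empty trees, with a label on each nonempty one. *)
pose E i : int := #|{: tree 'I_gamma i}|%:Z.
have defE i : E i = (i == 0%N)%:R + gamma%:Z * H i.
  case: i => [|i]; rewrite /E /H /=; first by rewrite card_tree0 mulr0 addr0.
  by rewrite card_treeS dim_Dendr PoszM add0r.
(* The right-hand side is [t] times the square of [E], so its coefficient at [n + 1] is that of the
   square at [n]. *)
rewrite /fps_t eqSS -(coef_square n defE) //.
rewrite /H /= dim_Dendr card_split_tree -natz natr_sum; apply: eq_bigr => i _.
by rewrite natrM !natz.
Qed.
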